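(* There is an algorithm which, given as input a binary video $\mathcal V=(I_i)_{i=1}^n$ of resolution $(w,h)$ with foreground connectivity $\kappa\in\{4,8\}$, outputs the merge graph $\mathcal G(\pi_0(\mathbb F^\cup_{\mathcal V}))$ in time $\mathcal O(nwh)$, i.e. linear in the total number of pixels.
   Context: Running time is counted in elementary operations of a standard unit-cost RAM. **Binary images.** $\Omega_{w,h}=\{1,\dots,w\}\times\{1,\dots,h\}$. A binary image is a map $I:\Omega_{w,h}\to\{0,1\}$ with a foreground connectivity $\kappa_I\in\{4,8\}$. A binary video of resolution $(w,h)$ is a finite sequence $(I_i)_{i=1}^n$ of binary images on $\Omega_{w,h}$ with a common foreground connectivity $\kappa$. **Foreground regions.** Let $Q_{i,j}=[i-\frac12,i+\frac12]\times[j-\frac12,j+\frac12]$ and let $K^*$ be the cubical complex whose vertices are the points of $\Omega_{w,h}$, whose edges are the unit segments between horizontally or vertically neighbouring points, and whose 2-cells are the unit squares with all four corners in $\Omega_{w,h}$. If $\kappa_I=8$, $F_I\subset\mathbb R^2$ is the union of the closed squares $Q_{i,j}$ with $I(i,j)=1$. If $\kappa_I=4$, $F_I\subset\mathbb R^2$ is the union of all cells of $K^*$ whose vertices all lie in $I^{-1}(1)$. **Union diagram.** $I\vee J$ is the pointwise maximum with the same foreground connectivity. $\mathbb F^\cup_{\mathcal V}$ is the diagram of inclusions $F_{I_1}\to F_{I_1\vee I_2}\leftarrow F_{I_2}\to\cdots\to F_{I_{n-1}\vee I_n}\leftarrow F_{I_n}$, with spaces indexed $1,\dots,2n-1$. **Merge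 graph.** $\pi_0(\mathbb F^\cup_{\mathcal V})$ is the induced diagram of finite sets of path components. The merge graph $\mathcal G(\pi_0(\mathbb F^\cup_{\mathcal V}))$ is the directed levelled graph whose vertices at level $\ell\in\{1,\dots,2n-1\}$ are the path components of the $\ell$-th space, and which, for each inclusion between adjacent spaces, has an edge from each component $C$ of the source space to the component of the target space containing $C$. The output represents the vertices at each level by labels $1,2,\dots$ in bijection with the components, together with the list of edges. *)

(* Defs.v *)
From HB Require Import structures.
From mathcomp Require Import all_boot all_order all_algebra.
From mathcomp Require Import all_classical all_reals all_analysis.
Import Order.TTheory GRing.Theory Num.Theory numFieldNormedType.Exports.

Set Implicit Arguments.
Unset Strict Implicit.
Unset Printing Implicit Defensive.

Local Open Scope classical_set_scope.
Local Open Scope ring_scope.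

(** * Unit-cost RAM

    The random access machine of Cook and Reckhow, over the natural numbers:
    registers X_0, X_1, ... each holding a natural number and initially 0, a
    read-only input tape, a write-only output tape, and addition and truncated
    subtraction as the only arithmetic.  Every executed instruction costs 1. *)

Inductive instr : Type :=
| RConst of nat & nat        (* RConst r c   : X_r := c *)
| RAdd of nat & nat & nat    (* RAdd r s t   : X_r := X_s + X_t *)
| RSub of nat & nat & nat    (* RSub r s t   : X_r := X_s - X_t, truncated at 0 *)
| RLoad of nat & nat         (* RLoad r s    : X_r := X_(X_s) *)
| RStore of nat & nat        (* RStore r s   : X_(X_r) := X_s *)
| RJumpPos of nat & nat      (* RJumpPos r k : go to instruction k if X_r > 0 *)
| RRead of nat               (* RRead r      : X_r := next input number *)
| RPrint of nat.             (* RPrint r     : append X_r to the output *)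

Definition ram_program := seq instr.

Record config := Config {
  pc : nat;
  regs : nat -> nat;
  input : seq nat;
  output : seq nat }.

Definition set_reg (m : nat -> nat) (r v : nat) : nat -> nat :=
  fun k => if k == r then v else m k.

(* Reading past the end of the input is a fault: there is no next
   configuration, although the machine has not halted. *)
Definition exec (i : instr) (c : config) : option config :=
  let: Config k m inp out := c in
  match i with
  | RConst r a => Some (Config k.+1 (set_reg m r a) inp out)
  | RAdd r s t => Some (Config k.+1 (set_reg m r (m s + m t)%N) inp out)
  | RSub r s t => Some (Config k.+1 (set_reg m r (m s - m t)%N) inp out)
  | RLoad r s => Some (Config k.+1 (set_reg m r (m (m s))) inp out)
  | RStore r s => Some (Config k.+1 (set_reg m (m r) (m s)) inp out)
  | RJumpPos r j => Some (Config (if (0 < m r)%N then j else k.+1) m inp out)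
  | RRead r => if inp is a :: inp'
              then Some (Config k.+1 (set_reg m r a) inp' out) else None
  | RPrint r => Some (Config k.+1 m inp (rcons out (m r)))
  end.

Definition step (P : ram_program) (c : config) : option config :=
  if onth P (pc c) is Some i then exec i c else None.

Fixpoint run (P : ram_program) (t : nat) (c : config) : option config :=
  if t is t'.+1 then obind (run P t') (step P c) else Some c.

(* The machine halts when the program counter leaves the program. *)
Definition halted (P : ram_program) (c : config) : bool :=
  (size P <= pc c)%N.

Definition init_config (x : seq nat) : config := Config 0 (fun=> 0%N) x [::].

Definition computes_in (P : ram_program) (x : seq nat) (t : nat) (y : seq nat)
    : Prop :=
  exists c, [/\ run P t (init_config x) = Some c, halted P c & output c = y].

(** * Binary images and videos *)

Inductive connectivity := Conn4 | Conn8.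

(* The index (i, j), counted from 0, stands for the point (i + 1, j + 1) of
   {1, ..., w} x {1, ..., h}. *)
Definition binary_image (w h : nat) := {ffun 'I_w * 'I_h -> bool}.

Definition image_union (w h : nat) (I J : binary_image w h) : binary_image w h :=
  [ffun p => I p || J p].

Record video (n w h : nat) := Video {
  conn : connectivity;
  frames : n.-tuple (binary_image w h) }.

(** * Foreground regions *)

Section Foreground.
Variables (R : realType) (w h : nat).
Implicit Types (p lo hi : 'I_w * 'I_h) (I : binary_image w h).

Definition xcoord p : R := p.1.+1%:R.
Definition ycoord p : R := p.2.+1%:R.

Definition pixel_square p : set (R * R) :=
  `[xcoord p - 2^-1, xcoord p + 2^-1] `*` `[ycoord p - 2^-1, ycoord p + 2^-1].

(* The cells of the dual complex are the boxes with lower left corner [lo],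
   upper right corner [hi] and sides of length 0 or 1: vertices, horizontal and
   vertical edges, and unit squares. *)
Definition is_cell lo hi : bool :=
  (lo.1 <= hi.1 <= lo.1.+1)%N && (lo.2 <= hi.2 <= lo.2.+1)%N.

Definition cell lo hi : set (R * R) :=
  `[xcoord lo, xcoord hi] `*` `[ycoord lo, ycoord hi].

(* For a cell, the grid points in the closed box are exactly its corners. *)
Definition cell_vertex lo hi p : bool :=
  (lo.1 <= p.1 <= hi.1)%N && (lo.2 <= p.2 <= hi.2)%N.

Definition foreground (k : connectivity) I : set (R * R) :=
  match k with
  | Conn8 => \bigcup_(p in [set p | I p]) pixel_square p
  | Conn4 => \bigcup_(c in [set c : ('I_w * 'I_h) * ('I_w * 'I_h) |
                             is_cell c.1 c.2 /\
                             forall p, cell_vertex c.1 c.2 p -> I p])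
               cell c.1 c.2
  end.

End Foreground.

Arguments foreground R {w h} k I.

(** * Path components *)

Section PathComponents.
Variables (R : realType) (T : topologicalType).

Definition joined_in (A : set T) (x y : T) : Prop :=
  exists g : R -> T, [/\ {within `[0, 1], continuous g}, g 0 = x, g 1 = y &
                       forall t : R, 0 <= t <= 1 -> A (g t)].

Definition path_components (A : set T) : set (set T) :=
  [set joined_in A x | x in A].

End PathComponents.

(** * Union diagram and merge graph *)

Section MergeGraph.
Variables (R : realType) (n w h : nat) (V : video n w h).

(* [frame i] is I_(i+1).  The default image is never used at a valid level. *)
Definition frame (i : nat) : binary_image w h := nth [ffun=> false] (frames V) i.

Definition level (l : nat) : bool := (1 <= l <= n.*2.-1)%N.

(* Level 2i - 1 carries I_i and level 2i carries I_i v I_(i+1). *)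
Definition level_image (l : nat) : binary_image w h :=
  if odd l then frame l./2 else image_union (frame l./2.-1) (frame l./2).

Definition union_space (l : nat) : set (R * R) :=
  foreground R (conn V) (level_image l).

(* There is an inclusion from each odd level to the adjacent even ones. *)
Definition arrow (l l' : nat) : bool :=
  odd l && ((l' == l.+1) || (l == l'.+1)).

Definition merge_vertex (v : nat * set (R * R)) : Prop :=
  level v.1 /\ path_components R (union_space v.1) v.2.

Definition merge_edge (v v' : nat * set (R * R)) : Prop :=
  [/\ merge_vertex v, merge_vertex v', arrow v.1 v'.1 & v.2 `<=` v'.2].

End MergeGraph.

Arguments union_space R {n w h} V l.

(** * Input and output formats *)

Definition conn_code (k : connectivity) : nat :=
  match k with Conn4 => 4 | Conn8 => 8 end.

Definition encode_image (w h : nat) (I : binary_image w h) : seq nat :=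
  [seq nat_of_bool (I (i, j)) | j <- enum 'I_h, i <- enum 'I_w].

(* n, w, h, the connectivity, then the frames in order, each row by row. *)
Definition encode_video (n w h : nat) (V : video n w h) : seq nat :=
  [:: n; w; h; conn_code (conn V)] ++
  flatten [seq encode_image f | f <- frames V].

(* An edge from the a-th vertex of level l to the b-th vertex of level l'. *)
Definition edge_code := ((nat * nat) * (nat * nat))%type.

(* The number of levels, the number of vertices of each level, then the edges,
   each as four numbers. *)
Definition encode_graph (m : seq nat) (es : seq edge_code) : seq nat :=
  size m :: m ++ flatten [seq [:: e.1.1; e.1.2; e.2.1; e.2.2] | e <- es].

(* [out] describes the merge graph of [V] through some labelling [lab l] of the
   components of each level [l] by 1, ..., m_l.  Edges are listed once each, in
   any order. *)
Definition outputs_merge_graph (R : realType) (n w h : nat) (V : video n w h)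
    (out : seq nat) : Prop :=
  exists (m : seq nat) (lab : nat -> set (R * R) -> nat) (es : seq edge_code),
  [/\ size m = n.*2.-1,
      forall l, level n l ->
        set_bij (path_components R (union_space R V l))
                [set a | (1 <= a <= nth 0%N m l.-1)%N] (lab l),
      uniq es,
      forall l a l' b,
        ((l, a), (l', b)) \in es <->
        exists C C', [/\ merge_edge V (l, C) (l', C'),
                         lab l C = a & lab l' C' = b]
    & out = encode_graph m es].

(* Main.v *)
Require Import Defs.
From mathcomp Require Import all_boot all_order all_algebra.
From mathcomp Require Import all_classical all_reals all_analysis.
From mathcomp Require Import zify lra.

Set Implicit Arguments.
Unset Strict Implicit.
Unset Printing Implicit Defensive.

(** An inclusion of foregrounds sends the component of a pixel to the component of
    the same pixel. So it suffices to label the pixels of each level by the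
    components of its foreground and, for one pixel of every component at an odd
    level, to look up its labels at the neighbouring levels.

    The components can be computed on pixels. A foreground is a finite union of
    closed boxes; a box is convex, boxes that meet belong to pixels in the same
    component of the adjacency graph, and by connectedness of the segment a path
    cannot leave the union of the boxes of one graph component, which is closed
    like the union of the others. Hence path components of the foreground
    correspond to components of the pixel graph ([foreground_pixels]).

    The pixels are labelled by breadth-first search, which is linear without
    union-find. The images of all levels are stacked in one array and separated by
    a background row and column, so neighbours lie at four fixed offsets in both
    directions and no test for the boundary is needed ([pixel_index_adjacent],
    [touching_adjacent]); the union images are formed while reading. A step of the
    search either serves the queue or advances the raster scan for seeds. Both
    happen at most once for each cell, so twice as many steps as there are cells
    finish a level ([flood_level]). The seeds of the odd levels then give the list
    of edges ([mem_es], [uniq_es]).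

    The program is written in a small language with named variables, separate
    arrays and loops whose count is fixed on entry. Its translation to the RAM
    preserves the result and the exact number of steps ([compile_correct]), and
    total correctness with a time bound is proved by Hoare triples ([triple]). *)

(** * A structured language over the RAM *)

Inductive var :=
  VN | Vw | Vh | VK | VW | VS | Vdiag1 | Vdiag2 | Vpos | Vbit | Vlevels
| Vlevel | Vodd | Vnext | Vlimit | Vcount | Vhead | Vtail | Vcur | Vnbr
| Vseeds | Vidx.

Inductive array := Image | Label | Queue | SeedLevel | SeedIndex.

Definition var_code (x : var) : nat :=
  match x with
  | VN => 0 | Vw => 1 | Vh => 2 | VK => 3 | VW => 4 | VS => 5 | Vdiag1 => 6
  | Vdiag2 => 7 | Vpos => 8 | Vbit => 9 | Vlevels => 10 | Vlevel => 11
  | Vodd => 12 | Vnext => 13 | Vlimit => 14 | Vcount => 15 | Vhead => 16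
  | Vtail => 17 | Vcur => 18 | Vnbr => 19 | Vseeds => 20 | Vidx => 21
  end.

Definition array_code (a : array) : nat :=
  match a with
  | Image => 0 | Label => 1 | Queue => 2 | SeedLevel => 3 | SeedIndex => 4
  end.

Inductive expr :=
| Cst of nat
| Var of var
| Plus of expr & expr
| Minus of expr & expr
| Get of array & expr.

(** The number of iterations of [Repeat e c] is the value of [e] on entry, so
    every command terminates and the semantics is defined by recursion. *)
Inductive com :=
| Skip
| Assign of var & expr
| Put of array & expr & expr
| Read of var
| Print of expr
| Seq of com & com
| If of expr & com & com
| Repeat of expr & com.

Record state := State {
  vars : var -> nat;
  cells : array -> nat -> nat;
  unread : seq nat;
  printed : seq nat }.

Definition set_var (s : state) x v :=
  State (fun y => if var_code y == var_code x then v else vars s y)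
        (cells s) (unread s) (printed s).

Definition set_cell (s : state) a i v :=
  State (vars s)
        (fun b j => if (array_code b == array_code a) && (j == i) then v
                    else cells s b j)
        (unread s) (printed s).

Fixpoint value (e : expr) (s : state) : nat :=
  match e with
  | Cst c => c
  | Var x => vars s x
  | Plus e1 e2 => value e1 s + value e2 s
  | Minus e1 e2 => value e1 s - value e2 s
  | Get a e1 => cells s a (value e1 s)
  end.

(** Registers are split by their residue modulo 16, so that variables, scratch
    registers, loop counters and array cells never overlap, whatever the lengths
    of the arrays and the nesting of the loops. *)
Definition var_reg (x : var) := 16 * var_code x + 8.
Definition tmp_reg (d : nat) := 16 * d + 9.
Definition counter_reg (k : nat) := 16 * k + 10.
Definition cell_reg (a : array) (i : nat) := 16 * i + array_code a.

Definition address_code (a : array) (d : nat) : ram_program :=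
  [:: RAdd (tmp_reg d) (tmp_reg d) (tmp_reg d);
      RAdd (tmp_reg d) (tmp_reg d) (tmp_reg d);
      RAdd (tmp_reg d) (tmp_reg d) (tmp_reg d);
      RAdd (tmp_reg d) (tmp_reg d) (tmp_reg d);
      RConst (tmp_reg d.+1) (array_code a);
      RAdd (tmp_reg d) (tmp_reg d) (tmp_reg d.+1)].

(** The value ends in scratch register [d]; lower ones are left alone. *)
Fixpoint expr_code (e : expr) (d : nat) : ram_program :=
  match e with
  | Cst c => [:: RConst (tmp_reg d) c]
  | Var x => [:: RConst (tmp_reg d) 0;
                 RAdd (tmp_reg d) (var_reg x) (tmp_reg d)]
  | Plus e1 e2 => expr_code e1 d ++ expr_code e2 d.+1 ++
                 [:: RAdd (tmp_reg d) (tmp_reg d) (tmp_reg d.+1)]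
  | Minus e1 e2 => expr_code e1 d ++ expr_code e2 d.+1 ++
                 [:: RSub (tmp_reg d) (tmp_reg d) (tmp_reg d.+1)]
  | Get a e1 => expr_code e1 d ++ address_code a d ++
                [:: RLoad (tmp_reg d) (tmp_reg d)]
  end.

Fixpoint expr_size (e : expr) : nat :=
  match e with
  | Cst c => 1
  | Var x => 2
  | Plus e1 e2 | Minus e1 e2 => expr_size e1 + expr_size e2 + 1
  | Get a e1 => expr_size e1 + 7
  end.

(** [k] is the number of enclosing loops and [p] the position of the first
    instruction, from which the absolute jump targets are computed. *)
Fixpoint compile (c : com) (k p : nat) : ram_program :=
  match c with
  | Skip => [::]
  | Assign x e => expr_code e 0 ++
      [:: RConst (tmp_reg 1) 0; RAdd (var_reg x) (tmp_reg 0) (tmp_reg 1)]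
  | Put a e1 e2 => expr_code e1 0 ++ address_code a 0 ++ expr_code e2 1 ++
      [:: RStore (tmp_reg 0) (tmp_reg 1)]
  | Read x => [:: RRead (var_reg x)]
  | Print e => expr_code e 0 ++ [:: RPrint (tmp_reg 0)]
  | Seq c1 c2 =>
      let code1 := compile c1 k p in
      code1 ++ compile c2 k (p + size code1)
  | If e c1 c2 =>
      let p2 := p + expr_size e + 1 in
      let code2 := compile c2 k p2 in
      let p1 := p2 + size code2 + 2 in
      let code1 := compile c1 k p1 in
      expr_code e 0 ++ [:: RJumpPos (tmp_reg 0) p1] ++ code2 ++
      [:: RConst (tmp_reg 0) 1; RJumpPos (tmp_reg 0) (p1 + size code1)] ++
      code1
  | Repeat e c1 =>
      let p1 := p + expr_size e + 4 in
      let code1 := compile c1 k.+1 p1 in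
      expr_code e 0 ++
      [:: RConst (tmp_reg 1) 0; RAdd (counter_reg k) (tmp_reg 0) (tmp_reg 1);
          RConst (tmp_reg 0) 1; RJumpPos (tmp_reg 0) (p1 + size code1 + 2)] ++
      code1 ++
      [:: RConst (tmp_reg 0) 1;
          RSub (counter_reg k) (counter_reg k) (tmp_reg 0);
          RJumpPos (counter_reg k) p1]
  end.

(** The semantics counts the instructions that the compiled code executes; it is
    undefined only when a [Read] finds no input. *)
Definition option_add (t : nat) (r : option (nat * state)) :=
  omap (fun ts => (t + ts.1, ts.2)) r.

(** The 3 instructions of each iteration decrement the counter and test it. *)
Fixpoint loop (f : state -> option (nat * state)) (n : nat) (s : state) :=
  if n is n'.+1 then obind (fun ts => option_add (ts.1 + 3) (loop f n' ts.2)) (f s)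
  else Some (0, s).

Fixpoint eval (c : com) (s : state) : option (nat * state) :=
  match c with
  | Skip => Some (0, s)
  | Assign x e => Some (expr_size e + 2, set_var s x (value e s))
  | Put a e1 e2 => Some (expr_size e1 + expr_size e2 + 7,
                         set_cell s a (value e1 s) (value e2 s))
  | Read x => if unread s is a :: u then
                Some (1, set_var (State (vars s) (cells s) u (printed s)) x a)
              else None
  | Print e => Some (expr_size e + 1,
                     State (vars s) (cells s) (unread s)
                           (rcons (printed s) (value e s)))
  | Seq c1 c2 => obind (fun ts => option_add ts.1 (eval c2 ts.2)) (eval c1 s)
  | If e c1 c2 => if 0 < value e s then option_add (expr_size e + 1) (eval c1 s)
                  else option_add (expr_size e + 3) (eval c2 s)
  | Repeat e c1 => option_add (expr_size e + 5) (loop (eval c1) (value e s) s)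
  end.

(** ** Correctness of the compilation *)

Definition code_at (P : ram_program) (p : nat) (code : ram_program) :=
  forall i, i < size code -> onth P (p + i) = onth code i.

Lemma code_at_cat P p c1 c2 :
  code_at P p (c1 ++ c2) -> code_at P p c1 /\ code_at P (p + size c1) c2.
Proof.
move=> H; split=> i Hi.
  by rewrite H ?size_cat ?ltn_addr // onth_cat Hi.
rewrite -addnA H ?size_cat ?ltn_add2l // onth_cat.
by rewrite ltnNge leq_addr /= addKn.
Qed.

Lemma code_at_cons P p i c :
  code_at P p (i :: c) -> onth P p = Some i /\ code_at P p.+1 c.
Proof.
move=> H; split; first by have := H 0 isT; rewrite addn0.
by move=> j Hj; rewrite addSnnS H.
Qed.

Definition reach P t c c' := run P t c = Some c'.

Lemma reach0 P p p' m u o :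
  p = p' -> reach P 0 (Config p m u o) (Config p' m u o).
Proof. by move=> ->. Qed.

Lemma reach_trans P t1 t2 c1 c2 c3 :
  reach P t1 c1 c2 -> reach P t2 c2 c3 -> reach P (t1 + t2) c1 c3.
Proof.
rewrite /reach; elim: t1 c1 => [|t1 IH] c1 /=; first by case=> ->.
by case: (step P c1) => //= c; apply: IH.
Qed.

Lemma reach_step P t p i m u o c1 c2 :
  onth P p = Some i -> exec i (Config p m u o) = Some c1 ->
  reach P t c1 c2 -> reach P t.+1 (Config p m u o) c2.
Proof. by rewrite /reach /= /step /= => -> ->. Qed.

Definition represents (s : state) (m : nat -> nat) :=
  (forall x, m (var_reg x) = vars s x) /\
  (forall a i, m (cell_reg a i) = cells s a i).

Definition is_tmp (d r : nat) := exists2 d', d <= d' & r = tmp_reg d'.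

Lemma tmpN_var d x : ~ is_tmp d (var_reg x).
Proof. by case=> d' _; rewrite /tmp_reg /var_reg; lia. Qed.

Lemma tmpN_cell d a i : ~ is_tmp d (cell_reg a i).
Proof. by case=> d' _; rewrite /tmp_reg /cell_reg; case: a => /=; lia. Qed.

Lemma tmpN_counter d k : ~ is_tmp d (counter_reg k).
Proof. by case=> d' _; rewrite /tmp_reg /counter_reg; lia. Qed.

Lemma tmpN_lt d d' : d < d' -> ~ is_tmp d' (tmp_reg d).
Proof. by move=> lt_d [d2]; rewrite /tmp_reg; lia. Qed.

Lemma is_tmpS d r : is_tmp d.+1 r -> is_tmp d r.
Proof. by case=> d' /ltnW le_d ->; exists d'. Qed.

Lemma set_regN m r v r' : r' <> r -> set_reg m r v r' = m r'.
Proof. by rewrite /set_reg; case: eqP. Qed.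

Lemma set_regE m r v : set_reg m r v r = v.
Proof. by rewrite /set_reg eqxx. Qed.

Lemma set_tmp m d d' v r :
  d <= d' -> ~ is_tmp d r -> set_reg m (tmp_reg d') v r = m r.
Proof. by move=> le_d Hr; apply: set_regN => Er; apply: Hr; exists d'. Qed.

Definition agree d (m m' : nat -> nat) := forall r, ~ is_tmp d r -> m' r = m r.

Lemma agree_refl d m : agree d m m. Proof. by []. Qed.

Lemma agree_trans d m1 m2 m3 : agree d m1 m2 -> agree d m2 m3 -> agree d m1 m3.
Proof. by move=> H1 H2 r Hr; rewrite H2 ?H1. Qed.

Lemma agreeS d m m' : agree d.+1 m m' -> agree d m m'.
Proof. by move=> H r Hr; apply: H => /is_tmpS. Qed.

Lemma agree_set d d' m m' v :
  d <= d' -> agree d m m' -> agree d m (set_reg m' (tmp_reg d') v).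
Proof. by move=> le_d H r Hr; rewrite (set_tmp _ _ le_d) ?H. Qed.

Lemma represents_agree d s m m' :
  agree d m m' -> represents s m -> represents s m'.
Proof.
move=> H [Hv Hc]; split=> [x|a i]; rewrite H //.
  exact: tmpN_var.
exact: tmpN_cell.
Qed.

Lemma size_expr_code e d : size (expr_code e d) = expr_size e.
Proof.
elim: e d => //= [e1 IH1 e2 IH2|e1 IH1 e2 IH2|a e1 IH1] d;
  rewrite !size_cat /= ?IH1 ?IH2 //; lia.
Qed.

Lemma address_code_run P p a d i m u o :
  code_at P p (address_code a d) -> m (tmp_reg d) = i ->
  exists m', [/\ reach P 6 (Config p m u o) (Config (p + 6) m' u o),
    m' (tmp_reg d) = cell_reg a i & agree d m m'].
Proof.
do 6!move=> /code_at_cons[]?; move=> _ Em.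
eexists; split.
- do 6![apply: reach_step; [eassumption|reflexivity|]].
  by apply: reach0 => /=; lia.
- have neq : tmp_reg d <> tmp_reg d.+1 by rewrite /tmp_reg; lia.
  rewrite !(set_regE, set_regN _ _ neq) Em /cell_reg; lia.
- by do 6!apply: agree_set => //.
Qed.

Lemma expr_code_run P e p d s m u o :
  code_at P p (expr_code e d) -> represents s m ->
  exists m', [/\ reach P (expr_size e) (Config p m u o)
                       (Config (p + expr_size e) m' u o),
    m' (tmp_reg d) = value e s & agree d m m'].
Proof.
have binary e1 e2 i f p' d' m1 :
    (forall m2 o2 u2 q, exec i (Config q m2 u2 o2) =
      Some (Config q.+1
        (set_reg m2 (tmp_reg d') (f (m2 (tmp_reg d')) (m2 (tmp_reg d'.+1))))
        u2 o2)) ->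
    (forall p d m, code_at P p (expr_code e1 d) -> represents s m ->
      exists m', [/\ reach P (expr_size e1) (Config p m u o)
                       (Config (p + expr_size e1) m' u o),
      m' (tmp_reg d) = value e1 s & agree d m m']) ->
    (forall p d m, code_at P p (expr_code e2 d) -> represents s m ->
      exists m', [/\ reach P (expr_size e2) (Config p m u o)
                       (Config (p + expr_size e2) m' u o),
      m' (tmp_reg d) = value e2 s & agree d m m']) ->
    code_at P p' (expr_code e1 d' ++ expr_code e2 d'.+1 ++ [:: i]) ->
    represents s m1 ->
    exists m', [/\ reach P (expr_size e1 + expr_size e2 + 1) (Config p' m1 u o)
                 (Config (p' + (expr_size e1 + expr_size e2 + 1)) m' u o),
      m' (tmp_reg d') = f (value e1 s) (value e2 s) & agree d' m1 m'].
  move=> Hi H1 H2 /code_at_cat[C1 /code_at_cat[C2 /code_at_cons[C3 _]]] Hm.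
  have [m2 [R2 V2 A2]] := H1 _ _ _ C1 Hm.
  have [m3 [R3 V3 A3]] := H2 _ _ _ C2 (represents_agree A2 Hm).
  exists (set_reg m3 (tmp_reg d') (f (value e1 s) (value e2 s))).
  have E3 : m3 (tmp_reg d') = value e1 s by rewrite A3 //; apply: tmpN_lt.
  rewrite !size_expr_code in R3 C3.
  split; last 2 first.
  - exact: set_regE.
  - by apply: agree_set => //; apply: agree_trans A2 (agreeS A3).
  - rewrite -addnA; apply: reach_trans R2 _; apply: reach_trans R3 _.
    apply: (reach_step C3); first exact: Hi.
    by rewrite E3 V3; apply: reach0 => /=; lia.
elim: e p d m => [c|x|e1 IH1 e2 IH2|e1 IH1 e2 IH2|a e1 IH1] p d m.
- move=> /code_at_cons[C1 _] Hm; eexists; split.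
  + apply: (reach_step C1); first reflexivity.
    by apply: reach0 => /=; lia.
  + exact: set_regE.
  + by apply: agree_set.
- move=> /code_at_cons[C1 /code_at_cons[C2 _]] Hm; eexists; split.
  + apply: (reach_step C1); first reflexivity.
    apply: (reach_step C2); first reflexivity.
    by apply: reach0 => /=; lia.
  + rewrite set_regE set_regE addn0 (@set_tmp _ 0) ?(proj1 Hm) //.
    exact: tmpN_var.
  + by do 2!apply: agree_set => //.
- exact: (binary e1 e2 _ addn).
- exact: (binary e1 e2 _ subn).
- move=> /code_at_cat[C1 /code_at_cat[C2 /code_at_cons[C3 _]]] Hm.
  have [m2 [R2 V2 A2]] := IH1 _ _ _ C1 Hm.
  rewrite size_expr_code in C2 C3.
  have [m3 [R3 V3 A3]] := address_code_run u o C2 V2.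
  exists (set_reg m3 (tmp_reg d) (m3 (m3 (tmp_reg d)))); split.
  + rewrite /= -[7]/(6 + 1); apply: reach_trans R2 _; apply: reach_trans R3 _.
    apply: (reach_step C3); first reflexivity.
    by apply: reach0 => /=; lia.
  + rewrite set_regE V3.
    by have [_ ->] := represents_agree (agree_trans A2 A3) Hm.
  + by apply: agree_set => //; apply: agree_trans A2 A3.
Qed.

Lemma represents_set_var s m x v :
  represents s m -> represents (set_var s x v) (set_reg m (var_reg x) v).
Proof.
move=> [Hv Hc]; split=> [y|a i] /=.
  rewrite /set_reg Hv /var_reg eqn_add2r eqn_mul2l //=.
rewrite set_regN // /cell_reg /var_reg; case: a => /=; lia.
Qed.

Lemma represents_set_cell s m a i v :
  represents s m -> represents (set_cell s a i v) (set_reg m (cell_reg a i) v).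
Proof.
move=> [Hv Hc]; split=> [x|b j] /=.
  rewrite set_regN // /cell_reg /var_reg; case: a => /=; lia.
rewrite /set_reg Hc; congr (if _ then _ else _).
rewrite /cell_reg; case: a b => [] []; rewrite /=; lia.
Qed.

Lemma represents_set_counter s m k v :
  represents s m -> represents s (set_reg m (counter_reg k) v).
Proof.
move=> [Hv Hc]; split=> [x|a i]; rewrite set_regN //.
  by rewrite /counter_reg /var_reg; lia.
by rewrite /counter_reg /cell_reg; case: a => /=; lia.
Qed.

Definition keeps_counters k (m m' : nat -> nat) :=
  forall j, j < k -> m' (counter_reg j) = m (counter_reg j).

Lemma agree_keeps d k m m' : agree d m m' -> keeps_counters k m m'.
Proof. by move=> H j _; rewrite H //; apply: tmpN_counter. Qed.

Lemma keeps_trans k m1 m2 m3 :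
  keeps_counters k m1 m2 -> keeps_counters k m2 m3 -> keeps_counters k m1 m3.
Proof. by move=> H1 H2 j Hj; rewrite H2 ?H1. Qed.

Definition at_state p (s : state) m := Config p m (unread s) (printed s).

Definition simulates P p code k s t s' :=
  code_at P p code -> forall m, represents s m ->
  exists m', [/\ reach P t (at_state p s m) (at_state (p + size code) s' m'),
    represents s' m' & keeps_counters k m m'].

Lemma set_regC_keeps k m r v :
  (forall j, counter_reg j <> r) -> keeps_counters k m (set_reg m r v).
Proof. by move=> H j _; rewrite set_regN //; apply: H. Qed.

(** Loop counters live at the nesting depth of their loop, so the body of a loop
    leaves the counters of the enclosing loops unchanged; with this invariant a
    loop is an induction on its counter. *)
Theorem compile_correct P c : forall k p s t s',
  eval c s = Some (t, s') -> simulates P p (compile c k p) k s t s'.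
Proof.
elim: c => [|x e|a e1 e2|x|e|c1 IH1 c2 IH2|e c1 IH1 c2 IH2|e c1 IH1] k p s t s'.
- case=> <- <- _ m Hm; by exists m; split=> //=; rewrite addn0.
- case=> <- <- /= /code_at_cat[C1 /code_at_cons[C2 /code_at_cons[C3 _]]] m Hm.
  have [m1 [R1 V1 A1]] := expr_code_run (unread s) (printed s) C1 Hm.
  rewrite !size_expr_code in C2 C3.
  eexists; split.
  + apply: reach_trans R1 _; apply: (reach_step C2); first reflexivity.
    apply: (reach_step C3); first reflexivity.
    by apply: reach0; rewrite size_cat size_expr_code /=; lia.
  + rewrite set_regE addn0 set_regN; last by rewrite /tmp_reg; lia.
    rewrite V1; apply: represents_set_var.
    exact: represents_agree (agree_set _ (leq0n 1) A1) Hm.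
  + apply: keeps_trans (agree_keeps A1) _ => j _.
    by rewrite !set_regN // /counter_reg /tmp_reg /var_reg; lia.
- case=> <- <- /code_at_cat[C1 /code_at_cat[C2 /code_at_cat[C3]]].
  move=> /code_at_cons[C4 _] m Hm.
  have [m1 [R1 V1 A1]] := expr_code_run (unread s) (printed s) C1 Hm.
  rewrite !size_expr_code in C2 C3 C4.
  have [m2 [R2 V2 A2]] := address_code_run (unread s) (printed s) C2 V1.
  have Hm2 := represents_agree (agree_trans A1 A2) Hm.
  have [m3 [R3 V3 A3]] := expr_code_run (unread s) (printed s) C3 Hm2.
  have E3 : m3 (tmp_reg 0) = cell_reg a (value e1 s).
    by rewrite A3 //; apply: tmpN_lt.
  eexists; split.
  + have -> : expr_size e1 + expr_size e2 + 7
      = expr_size e1 + (6 + (expr_size e2 + 1)) by lia.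
    apply: reach_trans R1 _; apply: reach_trans R2 _; apply: reach_trans R3 _.
    apply: (reach_step C4); first reflexivity.
    by apply: reach0; rewrite !size_cat !size_expr_code /=; lia.
  + rewrite E3 V3; apply: represents_set_cell.
    exact: represents_agree A3 Hm2.
  + apply: keeps_trans (agree_keeps A1) _.
    apply: keeps_trans (agree_keeps A2) _.
    apply: keeps_trans (agree_keeps A3) _.
    apply: set_regC_keeps => j; rewrite E3 /counter_reg /cell_reg.
    by case: (a) => /=; lia.
- rewrite /eval; case Eu: (unread s) => [//|v u] [<- <-] /code_at_cons[C1 _] m Hm.
  eexists; split.
  + rewrite /at_state Eu; apply: (reach_step C1); first reflexivity.
    by apply: reach0 => /=; lia.
  + exact: (@represents_set_var (State _ _ _ _)).
  + by apply: set_regC_keeps; rewrite /counter_reg /var_reg; lia.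
- case=> <- <- /code_at_cat[C1 /code_at_cons[C2 _]] m Hm.
  have [m1 [R1 V1 A1]] := expr_code_run (unread s) (printed s) C1 Hm.
  rewrite !size_expr_code in C2; exists m1; split.
  + apply: reach_trans R1 _; apply: (reach_step C2); first reflexivity.
    by rewrite V1; apply: reach0; rewrite size_cat size_expr_code /=; lia.
  + exact: represents_agree A1 Hm.
  + exact: agree_keeps A1.
- rewrite /=; case E1: (eval c1 s) => [[t1 s1]|] //=.
  case E2: (eval c2 s1) => [[t2 s2]|] //= [<- <-] /code_at_cat[C1 C2] m Hm.
  have [m1 [R1 Hm1 K1]] := IH1 _ _ _ _ _ E1 C1 _ Hm.
  have [m2 [R2 Hm2 K2]] := IH2 _ _ _ _ _ E2 C2 _ Hm1.
  exists m2; split=> //; last exact: keeps_trans K1 K2.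
  by apply: reach_trans R1 _; rewrite size_cat addnA.
- rewrite /= => Ee /code_at_cat[C1]; rewrite size_expr_code.
  move=> /code_at_cons[C2 /code_at_cat[C3]].
  move=> /code_at_cons[C4 /code_at_cons[C5 C6]] m Hm.
  rewrite -(addn1 (_ + _)) in C3 C4 C5 C6.
  have [m1 [R1 V1 A1]] := expr_code_run (unread s) (printed s) C1 Hm.
  have Hm1 := represents_agree A1 Hm.
  case: ifP Ee => [e_gt0|e_eq0].
    case E1: (eval c1 s) => [[t1 s1]|] //= [<- <-].
    rewrite -[in (_ + _).+2]addn2 in C6.
    have [m2 [R2 Hm2 K2]] := IH1 _ _ _ _ _ E1 C6 _ Hm1.
    exists m2; split=> //; last exact: keeps_trans (agree_keeps A1) K2.
    rewrite -addnA; apply: reach_trans R1 _; apply: (reach_step C2).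
      by rewrite /= V1 e_gt0.
    apply: (etrans R2); rewrite /at_state; congr (Some (Config _ _ _ _)).
    by rewrite !size_cat /= size_cat size_expr_code /=; lia.
  case E2: (eval c2 s) => [[t2 s2]|] //= [<- <-].
  have [m2 [R2 Hm2 K2]] := IH2 _ _ _ _ _ E2 C3 _ Hm1.
  eexists; split; last 2 first.
  + by apply: represents_agree (agree_set 1 (leqnn 0) (@agree_refl 0 m2)) Hm2.
  + apply: keeps_trans (agree_keeps A1) (keeps_trans K2 _).
    exact: agree_keeps (agree_set 1 (leqnn 0) (@agree_refl 0 m2)).
  + have -> : expr_size e + 3 + t2 = expr_size e + (1 + (t2 + 2)) by lia.
    apply: reach_trans R1 _; apply: (reach_step C2).
      by rewrite /= V1 e_eq0.
    rewrite -(addn1 (_ + _)); apply: reach_trans R2 _.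
    apply: (reach_step C4); first reflexivity.
    apply: (reach_step C5); first reflexivity.
    by apply: reach0; rewrite size_cat /= size_cat size_expr_code /=; lia.
- rewrite /=; set p1 := p + expr_size e + 4; set body := compile _ _ _.
  case El: loop => [[t1 s1]|] //= [<- <-] /code_at_cat[C1].
  rewrite size_expr_code => /code_at_cons[C2 /code_at_cons[C3]].
  move=> /code_at_cons[C4 /code_at_cons[C5 /code_at_cat[C6]]].
  move=> /code_at_cons[C7 /code_at_cons[C8 /code_at_cons[C9 _]]] m Hm.
  have Ep : (p + expr_size e).+4 = p1 by rewrite /p1; lia.
  rewrite {}Ep in C6 C7 C8 C9.
  have iter n : forall t s s' m', loop (eval c1) n s = Some (t, s') ->
      represents s m' -> m' (counter_reg k) = n ->
      exists m'', [/\ reach P (t + 1) (at_state (p1 + size body + 2) s m')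
        (at_state (p1 + size body + 3) s' m''), represents s' m''
        & keeps_counters k m' m''].
    elim: n => [|n IHn] t0 s0 s0' m0 /=.
      case=> <- <- Hm0 E0; exists m0; split=> //.
      apply: (@reach_step _ 0); first by rewrite addn2; exact: C9.
        by rewrite /= E0.
      by apply: reach0 => /=; lia.
    case E1: (eval c1 s0) => [[t2 s2]|] //=.
    case E2: loop => [[t3 s3]|] //= [<- <-] Hm0 E0.
    have [m1 [R1 Hm1 K1]] := IH1 _ _ _ _ _ E1 C6 _ Hm0.
    pose m2 := set_reg m1 (tmp_reg 0) 1.
    pose m3 := set_reg m2 (counter_reg k) n.
    have E3 : m2 (counter_reg k) - m2 (tmp_reg 0) = n.
      rewrite /m2 set_regE set_regN; last by rewrite /counter_reg /tmp_reg; lia.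
      by rewrite K1 // E0; lia.
    have Hm2 : represents s2 m2.
      exact: represents_agree (agree_set 1 (leqnn 0) (@agree_refl 0 m1)) Hm1.
    have [|m4 [R4 Hm4 K4]] :=
      IHn _ _ _ m3 E2 (represents_set_counter k n Hm2); first exact: set_regE.
    exists m4; split=> //.
      have -> : t2 + 3 + t3 + 1 = 1 + (t2 + (2 + (t3 + 1))) by lia.
      apply: (@reach_step _ _ _ _ _ _ _ (Config p1 m0 _ _)).
      + by rewrite addn2; exact: C9.
      + by rewrite /= E0.
      apply: reach_trans R1 _; apply: (reach_step C7); first reflexivity.
      apply: (reach_step C8); first by rewrite /= E3.
      by apply: etrans R4; rewrite addn2.
    apply: keeps_trans (_ : keeps_counters k m0 m3) K4.
    move=> j Hj; rewrite /m3 set_regN; last by rewrite /counter_reg; lia.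
    rewrite /m2 set_regN; last by rewrite /counter_reg /tmp_reg; lia.
    by rewrite K1 // ltnW.
  have [m1 [R1 V1 A1]] := expr_code_run (unread s) (printed s) C1 Hm.
  pose m2 := set_reg m1 (tmp_reg 1) 0.
  pose m3 := set_reg m2 (counter_reg k) (value e s).
  pose m4 := set_reg m3 (tmp_reg 0) 1.
  have Hm4 : represents s m4.
    apply: represents_agree (agree_set 1 (leqnn 0) (@agree_refl 0 m3)) _.
    apply: represents_set_counter.
    exact: represents_agree (agree_set _ (leq0n 1) A1) Hm.
  have E3 : m2 (tmp_reg 0) + m2 (tmp_reg 1) = value e s.
    by rewrite /m2 set_regE set_regN ?V1 ?addn0 // /tmp_reg; lia.
  have E4 : m4 (counter_reg k) = value e s.
    by rewrite /m4 /m3 set_regN ?set_regE // /counter_reg /tmp_reg; lia.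
  have [m5 [R5 Hm5 K5]] := iter _ _ _ _ _ El Hm4 E4.
  exists m5; split=> //.
  + have -> : expr_size e + 5 + t1 = expr_size e + (4 + (t1 + 1)) by lia.
    apply: reach_trans R1 _; apply: (reach_step C2); first reflexivity.
    apply: (reach_step C3); first by rewrite /= E3.
    apply: (reach_step C4); first reflexivity.
    apply: (reach_step C5); first reflexivity.
    apply: (etrans R5); rewrite /at_state; congr (Some (Config _ _ _ _)).
    by rewrite size_cat /= size_cat size_expr_code /= /p1; lia.
  + apply: keeps_trans (agree_keeps A1) (keeps_trans _ K5) => j Hj.
    rewrite /m4 set_regN; last by rewrite /counter_reg /tmp_reg; lia.
    rewrite /m3 set_regN; last by rewrite /counter_reg; lia.
    by rewrite /m2 set_regN // /counter_reg /tmp_reg; lia.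
Qed.

(** ** Total correctness with a time bound *)

(** A bound on time that does not depend on the state is enough: all sizes are
    fixed by the input. *)
Definition triple (Pre : state -> Prop) c T (Post : state -> Prop) :=
  forall s, Pre s -> exists t s', [/\ eval c s = Some (t, s'), t <= T & Post s'].

(** [wp] and [cost] serve loop-free commands, which [triple_wp] handles by
    computation; [triple_repeat] handles loops. *)
Fixpoint wp (c : com) (Post : state -> Prop) (s : state) : Prop :=
  match c with
  | Skip => Post s
  | Assign x e => Post (set_var s x (value e s))
  | Put a e1 e2 => Post (set_cell s a (value e1 s) (value e2 s))
  | Read x => if unread s is v :: u
              then Post (set_var (State (vars s) (cells s) u (printed s)) x v)
              else False
  | Print e => Post (State (vars s) (cells s) (unread s)
                           (rcons (printed s) (value e s)))
  | Seq c1 c2 => wp c1 (wp c2 Post) s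
  | If e c1 c2 => if 0 < value e s then wp c1 Post s else wp c2 Post s
  | Repeat _ _ => False
  end.

Fixpoint cost (c : com) : nat :=
  match c with
  | Skip => 0
  | Assign x e => expr_size e + 2
  | Put a e1 e2 => expr_size e1 + expr_size e2 + 7
  | Read x => 1
  | Print e => expr_size e + 1
  | Seq c1 c2 => cost c1 + cost c2
  | If e c1 c2 => expr_size e + 3 + (cost c1 + cost c2)
  | Repeat _ _ => 0
  end.

Lemma triple_wp Pre c Post :
  (forall s, Pre s -> wp c Post s) -> triple Pre c (cost c) Post.
Proof.
move=> H s /H {H}.
elim: c Post s => [|x e|a e1 e2|x|e|c1 IH1 c2 IH2|e c1 IH1 c2 IH2|e c1 _] //=
  Post s.
- by move=> H; exists 0, s.
- by move=> H; do 2!eexists; split; [reflexivity| |].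
- by move=> H; do 2!eexists; split; [reflexivity| |].
- by case: (unread s) => // v u H; do 2!eexists; split; [reflexivity| |].
- by move=> H; do 2!eexists; split; [reflexivity| |].
- move=> /IH1[t1 [s1 [-> le1 /IH2[t2 [s2 [E2 le2 H2]]]]]] /=.
  by rewrite E2 /=; do 2!eexists; split; [reflexivity|apply: leq_add|].
- case: ifP => _ => [/IH1|/IH2] [t1 [s1 [-> le1 H1]]] /=;
    do 2!eexists; split; try reflexivity; try done; lia.
Qed.

Lemma triple_seq Mid T1 T2 Pre c1 c2 Post :
  triple Pre c1 T1 Mid -> triple Mid c2 T2 Post ->
  triple Pre (Seq c1 c2) (T1 + T2) Post.
Proof.
move=> H1 H2 s /H1[t1 [s1 [/= -> le1 /H2[t2 [s2 [/= -> le2 H]]]]]] /=.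
by do 2!eexists; split; [reflexivity|apply: leq_add|].
Qed.

Lemma triple_weaken Pre' T' Post' Pre c T Post :
  triple Pre' c T' Post' -> (forall s, Pre s -> Pre' s) -> T' <= T ->
  (forall s, Post' s -> Post s) -> triple Pre c T Post.
Proof.
move=> H HP HT HQ s /HP /H[t [s' [E le_t HQ']]]; exists t, s'; split=> //.
  exact: leq_trans le_t HT.
exact: HQ.
Qed.

Lemma triple_repeat (Inv : nat -> state -> Prop) N T e c :
  (forall s, Inv 0 s -> value e s = N) ->
  (forall k, k < N -> triple (Inv k) c T (Inv k.+1)) ->
  triple (Inv 0) (Repeat e c) (expr_size e + 5 + N * (T + 3)) (Inv N).
Proof.
move=> HN Hc s Hs /=; rewrite HN //.
have iter n : forall k s, k + n = N -> Inv k s ->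
    exists t s', [/\ loop (eval c) n s = Some (t, s'), t <= n * (T + 3)
                   & Inv N s'].
  elim: n => [|n IHn] k s0 => [|Ek H0]; rewrite ?addn0.
    by move=> -> H0; exists 0, s0.
  have [|t1 [s1 [/= -> le1 H1]]] := Hc k _ _ H0; first by lia.
  have [|t2 [s2 [/= -> le2 H2]]] := IHn _ _ _ H1; first by lia.
  by do 2!eexists; split; [reflexivity| |] => //=; lia.
have [t [s' [-> le_t Hs']]] := iter _ 0 s (add0n N) Hs.
by do 2!eexists; split; [reflexivity|rewrite /= leq_add2l|].
Qed.

Definition blank_state (x : seq nat) := State (fun=> 0) (fun _ _ => 0) x [::].

(** The blank state is represented by registers that are all 0, as at the start
    of a run. *)
Theorem triple_computes c x T (Post : state -> Prop) :
  triple (eq (blank_state x)) c T Post ->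
  exists t s, [/\ computes_in (compile c 0 0) x t (printed s), t <= T & Post s].
Proof.
move=> /(_ _ erefl)[t [s [E le_t Hs]]]; exists t, s; split=> //.
have Hcode : code_at (compile c 0 0) 0 (compile c 0 0) by move=> i _.
have Hblank : represents (blank_state x) (fun=> 0) by split.
have [m [R _ _]] := compile_correct E Hcode Hblank.
by eexists; split; [exact: R|exact: leqnn|].
Qed.

(** * Breadth-first labelling of one level *)

Definition update (f : nat -> nat) i v j := if j == i then v else f j.

Section Flooding.

Variables (offsets : seq nat) (img : nat -> nat) (linked : nat -> nat -> Prop).
Variables (lo S : nat).

Definition adjacent (i j : nat) :=
  exists2 d, d \in offsets & j = i + d \/ i = j + d.

Definition in_level i := lo <= i < lo + S.

Lemma adjacent_sym i j : adjacent i j -> adjacent j i.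
Proof. by case=> d Hd [] E; exists d => //; [right|left]. Qed.

(** The labels of a level are correct for a relation [linked] when neighbours in
    the foreground have equal labels, and equal labels imply [linked] through the
    seed of the label: the [a]-th seed carries label [a + 1]. *)
Definition level_labelled (lab : nat -> nat) (sd : seq nat) :=
  [/\ forall a, a < size sd ->
        [/\ in_level (nth 0 sd a), 0 < img (nth 0 sd a)
          & lab (nth 0 sd a) = a.+1],
      forall i, in_level i -> 0 < img i ->
        0 < lab i <= size sd /\ linked i (nth 0 sd (lab i).-1)
    & forall i j, in_level i -> 0 < img i -> adjacent i j -> 0 < img j ->
        lab i = lab j].

(** The invariant of the search. Entries of the queue [q] before [hd] are
    processed: their neighbours already carry their label. Entries from [hd] on
    all carry the current label [cnt], since the queue is emptied before a new
    seed is taken; hence a new label never reaches a component that already has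
    one. The pixels before [next] have been scanned for seeds. *)
Record flooding (lab0 lab : nat -> nat) (q : seq nat) (hd next cnt : nat)
    (sd : seq nat) : Prop := Flooding {
  queue_uniq : uniq q;
  head_le : hd <= size q;
  next_range : lo <= next <= lo + S;
  count_le : lo + cnt <= next;
  seeds_size : size sd = cnt;
  queue_fg : forall i, i \in q -> in_level i /\ 0 < img i;
  queue_lab : forall i, i \in q ->
    0 < lab i <= cnt /\ linked i (nth 0 sd (lab i).-1);
  labelled_mem : forall i, in_level i -> 0 < lab i -> i \in q;
  processed : forall i j, i \in take hd q -> adjacent i j -> 0 < img j ->
    lab j = lab i;
  pending : forall i, i \in drop hd q -> lab i = cnt;
  scanned : forall i, lo <= i < next -> 0 < img i -> 0 < lab i;
  seeds_lab : forall a, a < cnt ->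
    nth 0 sd a \in q /\ lab (nth 0 sd a) = a.+1;
  other_levels : forall i, ~~ in_level i -> lab i = lab0 i }.

Hypothesis linked_refl : forall i, in_level i -> 0 < img i -> linked i i.
Hypothesis linked_trans : forall i j k, linked i j -> linked j k -> linked i k.
Hypothesis linked_adj : forall i j,
  in_level i -> 0 < img i -> adjacent i j -> 0 < img j ->
  in_level j /\ linked j i.

Section Steps.
Variables (lab0 lab : nat -> nat) (q : seq nat) (hd next cnt : nat) (sd : seq nat).
Hypothesis inv : flooding lab0 lab q hd next cnt sd.

Lemma queue_split i : i \in q -> i \in take hd q \/ i \in drop hd q.
Proof. by rewrite -{1}(cat_take_drop hd q) mem_cat => /orP. Qed.

Lemma queue_size : size q <= S.
Proof.
rewrite -(size_iota lo S); apply: uniq_leq_size (queue_uniq inv) _ => i Hi.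
by rewrite mem_iota; have [] := queue_fg inv Hi.
Qed.

(** An unlabelled neighbour of the head joins its component. It cannot be the
    neighbour of a processed pixel, since those have labelled neighbours only. *)
Lemma flooding_visit j :
  hd < size q -> adjacent (nth 0 q hd) j -> 0 < img j -> lab j = 0 ->
  flooding lab0 (update lab j cnt) (rcons q j) hd next cnt sd.
Proof.
move=> lt_hd adj_j fg_j lab_j; case: (inv) => Hu Hh Hn Hc Hs Hfg Hlab Hmem Hp Hd Hsc Hse Ho.
have cur_q : nth 0 q hd \in q by rewrite mem_nth.
have cur_lab : lab (nth 0 q hd) = cnt.
  by apply: Hd; rewrite (drop_nth 0) // mem_head.
have [lev_cur fg_cur] := Hfg _ cur_q.
have [lev_j link_j] := linked_adj lev_cur fg_cur adj_j fg_j.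
have [lab_cur link_cur] := Hlab _ cur_q.
have jNq : j \notin q by apply/negP => /Hlab[]; rewrite lab_j.
have upd i : i \in q -> update lab j cnt i = lab i.
  by rewrite /update; case: eqP => // -> ji; rewrite ji in jNq.
split=> //.
- by rewrite rcons_uniq jNq.
- by rewrite size_rcons ltnW.
- by move=> i; rewrite mem_rcons inE => /predU1P[->|/Hfg].
- move=> i; rewrite mem_rcons inE => /predU1P[->|i_q]; last by rewrite upd //; apply: Hlab.
  rewrite /update eqxx -{1 2 4}cur_lab; split=> //.
  exact: linked_trans link_j link_cur.
- move=> i lev_i; rewrite mem_rcons inE /update; case: eqP => //= _.
  exact: Hmem.
- move=> i k; rewrite -cats1 take_cat lt_hd => Hi adj_k fg_k.
  have lab_k := Hp _ _ Hi adj_k fg_k.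
  have [lab_i _] := Hlab _ (mem_take Hi).
  rewrite (upd i) ?(mem_take Hi) // /update; case: (k =P j) => [Ek|_] //; move: lab_k; rewrite Ek; lia.
- move=> i; rewrite -cats1 drop_cat lt_hd mem_cat inE /update.
  by case: eqP => //= _; rewrite orbF; apply: Hd.
- move=> i Hi fg_i; rewrite /update; case: eqP => // _; last exact: Hsc.
  by rewrite -cur_lab; lia.
- move=> a /Hse[s_q s_lab]; rewrite mem_rcons inE s_q orbT upd //.
- move=> i Hi; rewrite /update; case: eqP => [Ei|_]; last exact: Ho.
  by rewrite Ei lev_j in Hi.
Qed.

(** The head becomes processed once its neighbours are labelled. A neighbour that
    was itself processed has the same label by symmetry of adjacency, and one that
    is pending has the current label. *)
Lemma flooding_pop :
  hd < size q ->
  (forall j, adjacent (nth 0 q hd) j -> 0 < img j -> 0 < lab j) ->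
  flooding lab0 lab q hd.+1 next cnt sd.
Proof.
move=> lt_hd Hadj; case: (inv) => Hu Hh Hn Hc Hs Hfg Hlab Hmem Hp Hd Hsc Hse Ho.
have cur_q : nth 0 q hd \in q by rewrite mem_nth.
have cur_lab : lab (nth 0 q hd) = cnt.
  by apply: Hd; rewrite (drop_nth 0) // mem_head.
have [lev_cur fg_cur] := Hfg _ cur_q.
split=> //.
- move=> i j; rewrite (take_nth 0) // mem_rcons inE => /predU1P[->|]; last exact: Hp.
  move=> adj_j fg_j; have [lev_j _] := linked_adj lev_cur fg_cur adj_j fg_j.
  have [j_take|/Hd -> //] := queue_split (Hmem _ lev_j (Hadj _ adj_j fg_j)).
  by rewrite (Hp _ _ j_take (adjacent_sym adj_j) fg_cur).
- by move=> i Hi; apply: Hd; rewrite (drop_nth 0) // inE Hi orbT.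
Qed.

Lemma flooding_skip :
  next < lo + S -> (0 < img next -> 0 < lab next) ->
  flooding lab0 lab q hd next.+1 cnt sd.
Proof.
move=> lt_n Hnext; case: (inv) => Hu Hh Hn Hc Hs Hfg Hlab Hmem Hp Hd Hsc Hse Ho.
split=> //; [by lia|by lia|].
move=> i Hi fg_i; have [Ei|Ei] := eqVneq i next; first by rewrite Ei in fg_i *; apply: Hnext.
by apply: Hsc => //; lia.
Qed.

(** With an empty queue everything labelled is processed, so the next unlabelled
    foreground pixel starts a new component. *)
Lemma flooding_seed :
  hd = size q -> next < lo + S -> 0 < img next -> lab next = 0 ->
  flooding lab0 (update lab next cnt.+1) (rcons q next) hd next.+1 cnt.+1
    (rcons sd next).
Proof.
move=> Ehd lt_n fg_n lab_n.
case: (inv) => Hu Hh Hn Hc Hs Hfg Hlab Hmem Hp Hd Hsc Hse Ho.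
have lev_n : in_level next by rewrite /in_level lt_n andbT; case/andP: Hn.
have nNq : next \notin q by apply/negP => /Hlab[]; rewrite lab_n.
have upd i : i \in q -> update lab next cnt.+1 i = lab i.
  by rewrite /update; case: eqP => // -> ji; rewrite ji in nNq.
split=> //.
- by rewrite rcons_uniq nNq.
- by rewrite size_rcons Ehd.
- by lia.
- by lia.
- by rewrite size_rcons Hs.
- by move=> i; rewrite mem_rcons inE => /predU1P[->|/Hfg].
- move=> i; rewrite mem_rcons inE => /predU1P[->|i_q].
    by rewrite /update eqxx /= nth_rcons Hs ltnn eqxx leqnn; split=> //; apply: linked_refl.
  rewrite upd // nth_rcons Hs; have [lab_i] := Hlab _ i_q.
  have -> : (lab i).-1 < cnt by lia.
  by split=> //; case/andP: lab_i => -> /leqW.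
- move=> i lev_i; rewrite mem_rcons inE /update; case: eqP => //= _.
  exact: Hmem.
- move=> i k; rewrite Ehd -cats1 take_size_cat // -[X in i \in X](take_size q) -Ehd.
  move=> Hi adj_k fg_k; have lab_k := Hp _ _ Hi adj_k fg_k.
  have [lab_i _] := Hlab _ (mem_take Hi).
  rewrite (upd i) ?(mem_take Hi) // /update; case: (k =P next) => [Ek|_] //; move: lab_k; rewrite Ek; lia.
- move=> i; rewrite Ehd -cats1 drop_size_cat // inE => /eqP ->.
  by rewrite /update eqxx.
- move=> i Hi fg_i; rewrite /update; case: eqP => // Ei.
  by apply: Hsc => //; lia.
- move=> a Ha; rewrite nth_rcons Hs; case: (ltnP a cnt) => [lt_a|ge_a].
    by have [s_q s_lab] := Hse _ lt_a; rewrite mem_rcons inE s_q orbT upd.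
  have -> : a = cnt by lia.
  by rewrite eqxx mem_rcons mem_head /update eqxx.
- move=> i Hi; rewrite /update; case: eqP => [Ei|_]; last exact: Ho.
  by rewrite Ei lev_n in Hi.
Qed.

Lemma flooding_done : hd = size q -> next = lo + S -> level_labelled lab sd.
Proof.
move=> Ehd En; case: (inv) => Hu Hh Hn Hc Hs Hfg Hlab Hmem Hp Hd Hsc Hse Ho.
have fg_q i : in_level i -> 0 < img i -> i \in q.
  by move=> lev_i fg_i; apply: Hmem => //; apply: Hsc => //; rewrite En.
split.
- rewrite Hs => a /Hse[s_q ->]; have [] := Hfg _ s_q; split=> //.
- by rewrite Hs => i lev_i fg_i; apply/Hlab/fg_q.
- move=> i j lev_i fg_i adj_j fg_j; apply/esym/Hp => //.
  by rewrite Ehd take_size; apply: fg_q.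
Qed.

End Steps.

Lemma flooding_start lab0 :
  (forall i, in_level i -> lab0 i = 0) ->
  flooding lab0 lab0 [::] 0 lo 0 [::].
Proof.
move=> H0; split=> //; [by rewrite leqnn leq_addr|by rewrite addn0| |].
- by move=> i /H0 ->.
- by move=> i; rewrite ltnNge andbN.
Qed.

Lemma level_labelled_ext lab lab' sd :
  (forall i, in_level i -> lab' i = lab i) ->
  level_labelled lab sd -> level_labelled lab' sd.
Proof.
move=> E [H1 H2 H3]; split.
- by move=> a /H1[lev fg lab_a]; rewrite E.
- by move=> i lev_i /(H2 _ lev_i); rewrite E.
- move=> i j lev_i fg_i adj_j fg_j; have [lev_j _] := linked_adj lev_i fg_i adj_j fg_j.
  by rewrite !E //; apply: H3.
Qed.

End Flooding.

(** * The program *)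

Coercion Cst : nat >-> expr.
Coercion Var : var >-> expr.

Definition block (cs : seq com) : com := foldr Seq Skip cs.

Definition read_header : com :=
  block [:: Read VN; Read Vw; Read Vh; Read VK; Assign VW (Plus Vw 1)].

(** Neighbours lie at distance 1 and [VW], and for 8-connectivity also at
    [VW - 1] and [VW + 1]. For 4-connectivity the diagonal offsets repeat the
    others, so that the search needs no case distinction. *)
Definition set_offsets : com := block
  [:: If (Minus VK 4)
         (block [:: Assign Vdiag1 Vw; Assign Vdiag2 (Plus VW 1)])
         (block [:: Assign Vdiag1 1; Assign Vdiag2 VW]);
      Assign Vpos (Plus VS (Plus VW 1))].

(** A pixel of a frame belongs to the level of the frame and to the two
    neighbouring union levels, so it is added three times. The levels 0 and 2n,
    outside the merge graph, receive copies that are never labelled. *)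
Definition read_pixel : com := block
  [:: Read Vbit;
      Put Image Vpos (Plus (Get Image Vpos) Vbit);
      Put Image (Plus Vpos VS) (Plus (Get Image (Plus Vpos VS)) Vbit);
      Put Image (Minus Vpos VS) (Plus (Get Image (Minus Vpos VS)) Vbit);
      Assign Vpos (Plus Vpos 1)].

Definition read_row : com :=
  Seq (Repeat Vw read_pixel) (Assign Vpos (Plus Vpos 1)).

Definition read_frame : com :=
  Seq (Repeat Vh read_row) (Assign Vpos (Plus Vpos (Plus VS VW))).

Definition read_frames : com :=
  Seq read_header
  (Seq (Repeat (Plus Vh 1) (Assign VS (Plus VS VW)))
  (Seq set_offsets (Repeat VN read_frame))).

Definition visit (e : expr) : com := block
  [:: Assign Vnbr e;
      If (Get Image Vnbr)
         (If (Get Label Vnbr) Skip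
             (block [:: Put Label Vnbr Vcount; Put Queue Vtail Vnbr;
                        Assign Vtail (Plus Vtail 1)]))
         Skip].

Definition pop_queue : com := block
  [:: Assign Vcur (Get Queue Vhead);
      Assign Vhead (Plus Vhead 1);
      visit (Plus Vcur 1); visit (Minus Vcur 1);
      visit (Plus Vcur VW); visit (Minus Vcur VW);
      visit (Plus Vcur Vdiag1); visit (Minus Vcur Vdiag1);
      visit (Plus Vcur Vdiag2); visit (Minus Vcur Vdiag2)].

(** The seed is stored at every level, but the end of the list moves only at odd
    levels, where edges start; elsewhere the next seed overwrites it. *)
Definition new_seed : com := block
  [:: Assign Vcount (Plus Vcount 1);
      Put Label Vnext Vcount;
      Put Queue Vtail Vnext;
      Assign Vtail (Plus Vtail 1);
      Put SeedLevel Vseeds Vlevel;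
      Put SeedIndex Vseeds Vnext;
      Assign Vseeds (Plus Vseeds Vodd)].

Definition scan_pixel : com :=
  If (Minus Vlimit Vnext)
     (block [:: If (Get Image Vnext) (If (Get Label Vnext) Skip new_seed) Skip;
                Assign Vnext (Plus Vnext 1)])
     Skip.

(** One step serves the queue or, if it is empty, the raster scan. Repeating this
    step flattens the nested loops of a flood fill, so its time needs no
    amortization. *)
Definition flood_step : com := If (Minus Vtail Vhead) pop_queue scan_pixel.

Definition enter_level : com := block
  [:: Assign Vnext Vlimit; Assign Vlimit (Plus Vlimit VS);
      Assign Vcount 0; Assign Vhead 0; Assign Vtail 0].

Definition leave_level : com := block
  [:: Print Vcount; Assign Vlevel (Plus Vlevel 1); Assign Vodd (Minus 1 Vodd)].

Definition label_level : com :=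
  block [:: enter_level; Repeat (Plus VS VS) flood_step; leave_level].

Definition start_levels : com := block
  [:: Assign Vlevels (Minus (Plus VN VN) 1); Print Vlevels;
      Assign Vlevel 1; Assign Vodd 1; Assign Vlimit VS].

Definition label_levels : com :=
  Seq start_levels (Repeat Vlevels label_level).

Definition print_seed_edges : com := block
    [:: Assign Vcur (Get SeedIndex Vidx);
        Assign Vlevel (Get SeedLevel Vidx);
        If (Minus Vlevel 1)
           (block [:: Print Vlevel; Print (Get Label Vcur);
                      Print (Minus Vlevel 1); Print (Get Label (Minus Vcur VS))])
           Skip;
        If (Minus Vlevels Vlevel)
           (block [:: Print Vlevel; Print (Get Label Vcur);
                      Print (Plus Vlevel 1); Print (Get Label (Plus Vcur VS))])
           Skip;
        Assign Vidx (Plus Vidx 1)].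

Definition print_edges : com := Repeat Vseeds print_seed_edges.

Definition merge_graph_program : com :=
  Seq read_frames (Seq label_levels print_edges).

(** ** Labelling one level *)

Lemma triple_if Pre e c1 c2 T1 T2 Post :
  triple (fun s => Pre s /\ 0 < value e s) c1 T1 Post ->
  triple (fun s => Pre s /\ value e s = 0) c2 T2 Post ->
  triple Pre (If e c1 c2) (expr_size e + 3 + (T1 + T2)) Post.
Proof.
move=> H1 H2 s Hs /=; case: ifPn => He.
  have [t [s' [/= -> le_t Hs']]] := H1 _ (conj Hs He).
  by do 2!eexists; split; [reflexivity| |] => //=; lia.
rewrite -leqNgt leqn0 in He.
have [t [s' [/= -> le_t Hs']]] := H2 _ (conj Hs (eqP He)).
by do 2!eexists; split; [reflexivity| |] => //=; lia.
Qed.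

Lemma triple_block_cons Mid Pre c cs Post :
  triple Pre c (cost c) Mid ->
  triple Mid (block cs) (cost (block cs)) Post ->
  triple Pre (block (c :: cs)) (cost (block (c :: cs))) Post.
Proof. exact: triple_seq. Qed.

Lemma mkseqS T (f : nat -> T) n : mkseq f n.+1 = rcons (mkseq f n) (f n).
Proof. by rewrite /mkseq -addn1 iotaD map_cat /= add0n cats1. Qed.

Lemma eq_mkseq_lt T (f g : nat -> T) n :
  (forall i, i < n -> f i = g i) -> mkseq f n = mkseq g n.
Proof.
by move=> E; apply/eq_in_map => i; rewrite mem_iota add0n => /andP[_ /E].
Qed.

Definition queue s := mkseq (cells s Queue) (vars s Vtail).

Definition seed_list s :=
  mkseq (fun k => (cells s SeedLevel k, cells s SeedIndex k)) (vars s Vseeds).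

Definition level_seeds (l : nat) (sd : seq nat) : seq (nat * nat) :=
  if odd l then [seq (l, i) | i <- sd] else [::].

Lemma level_seeds_rcons l sd i :
  level_seeds l (rcons sd i) =
  level_seeds l sd ++ (if odd l then [:: (l, i)] else [::]).
Proof. by rewrite /level_seeds; case: odd; rewrite // map_rcons cats1. Qed.

Section Level.

Variables (N W S d1 d2 L : nat) (img : nat -> nat) (linked : nat -> nat -> Prop).
Variables (lo l : nat) (seeds0 : seq (nat * nat)) (out : seq nat).
Variable lab0 : nat -> nat.

Let offsets := [:: 1; W; d1; d2].

Hypothesis linked_refl : forall i, in_level lo S i -> 0 < img i -> linked i i.
Hypothesis linked_trans : forall i j k, linked i j -> linked j k -> linked i k.
Hypothesis linked_adj : forall i j,
  in_level lo S i -> 0 < img i -> adjacent offsets i j -> 0 < img j ->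
  in_level lo S j /\ linked j i.
Hypothesis offsets_le : forall d : nat, d \in offsets -> d <= lo.

(** The part of the state that the search within one level never changes. As a
    tuple, it is preserved by conversion under every other assignment. *)
Definition fixed s :=
  (vars s VN, vars s VW, vars s VS, vars s Vdiag1, vars s Vdiag2, vars s Vlevels,
   vars s Vlevel, vars s Vodd, vars s Vlimit, vars s Vidx, cells s Image, printed s).

Definition fixed_value :=
  (N, W, S, d1, d2, L, l, nat_of_bool (odd l), lo + S, 0, img, out).

Definition flood_inv s sd hd :=
  [/\ flooding offsets img linked lo S lab0 (cells s Label) (queue s) hd
        (vars s Vnext) (vars s Vcount) sd,
      fixed s = fixed_value &
      seed_list s = seeds0 ++ level_seeds l sd].

(** The state while the neighbours of [c], the entry [hd] of the queue, are being
    visited; the register [Vhead] has already moved past it. *)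
Definition visiting sd hd next c (visited : seq nat) s :=
  [/\ flood_inv s sd hd,
      [/\ vars s Vhead = hd.+1, vars s Vnext = next & vars s Vcur = c], hd < vars s Vtail, nth 0 (queue s) hd = c &
      forall j, j \in visited -> 0 < img j -> 0 < cells s Label j].

Lemma visit_triple sd hd next c visited e j :
  (forall s, visiting sd hd next c visited s -> value e s = j) ->
  adjacent offsets c j ->
  triple (visiting sd hd next c visited) (visit e) (cost (visit e))
    (visiting sd hd next c (j :: visited)).
Proof.
move=> He adj_j; apply: triple_wp => s Hs; move: (He s Hs) => {}He.
case: Hs => [[Hfl Hfix Hseeds] [Hhd Hnext Hc] Hlt Hnth Hvis] /=.
have Eimg : cells s Image = img by case: Hfix.
rewrite He Eimg; case: ifP => [fg_j|/negbT fgN_j]; last first.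
  split=> // k; rewrite inE => /predU1P[->|]; last exact: Hvis.
  by rewrite (negbTE fgN_j).
case: ifP => [lab_j|/negbT labN_j].
  by split=> // k; rewrite inE => /predU1P[->|]; last exact: Hvis.
have lab_j : cells s Label j = 0 by lia.
have Hsz : size (queue s) = vars s Vtail by rewrite size_mkseq.
have := flooding_visit linked_trans linked_adj Hfl (j := j).
rewrite Hsz Hnth => /(_ Hlt adj_j fg_j lab_j) Hfl'.
rewrite /visiting /flood_inv /queue /= addn1 mkseqS eqxx (@eq_mkseq_lt _ _ (cells s Queue)); last first.
  by move=> i lt_i; case: eqP => // Ei; rewrite Ei ltnn in lt_i.
have cur_q : c \in queue s by rewrite -Hnth mem_nth ?Hsz.
have [cnt_gt0 _] := queue_lab Hfl cur_q.
split=> //.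
- exact: ltnW.
- by rewrite nth_rcons Hsz Hlt.
- move=> k; rewrite inE => /predU1P[->|k_vis] fg_k; first by rewrite eqxx; lia.
  by case: eqP => _; [lia|apply: Hvis].
Qed.

(** After [k] steps either [k] pops and scans have been made or the level is
    finished. *)
Definition level_inv k s := exists sd,
  flood_inv s sd (vars s Vhead) /\
  (vars s Vhead + vars s Vnext = lo + k \/
   vars s Vhead = vars s Vtail /\ vars s Vnext = lo + S).

Lemma visit_neighbours sd hd next c :
  triple (fun s => [/\ flood_inv s sd hd, vars s Vhead = hd /\ vars s Vnext = next,
                       hd < vars s Vtail & nth 0 (queue s) hd = c])
    pop_queue (cost pop_queue)
    (visiting sd hd next c [:: c - d2; c + d2; c - d1; c + d1; c - W; c + W;
                               c - 1; c + 1]).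
Proof.
set Pre := fun s => _; suff Hpop : lo <= c -> triple Pre pop_queue (cost pop_queue)
    (visiting sd hd next c [:: c - d2; c + d2; c - d1; c + d1; c - W; c + W;
                               c - 1; c + 1]).
  move=> s Hs; apply: Hpop (Hs); case: Hs => [[Hfl _ _] _ lt_hd Ec].
  have : c \in queue s by rewrite -Ec mem_nth // size_mkseq.
  by case/(queue_fg Hfl) => /andP[].
move=> ge_c.
have fwd d : d \in offsets -> adjacent offsets c (c + d) by exists d => //; left.
have bwd d : d \in offsets -> adjacent offsets c (c - d).
  move=> Hd; exists d => //; right; rewrite subnK //.
  exact: leq_trans (offsets_le Hd) ge_c.
have o1 : 1 \in offsets by rewrite !inE eqxx.
have oW : W \in offsets by rewrite !inE eqxx !orbT.
have od1 : d1 \in offsets by rewrite !inE eqxx !orbT.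
have od2 : d2 \in offsets by rewrite !inE eqxx !orbT.
have fixedE V s : visiting sd hd next c V s ->
    [/\ vars s Vcur = c, vars s VW = W, vars s Vdiag1 = d1 & vars s Vdiag2 = d2].
  by case=> [[_ Hfix _] [_ _ ->] _ _ _]; case: Hfix => *; split.
rewrite /pop_queue.
apply: (triple_block_cons (Mid := fun s => Pre s /\ vars s Vcur = c)).
  apply: triple_wp => s [Hi [Ehd En] lt_hd Ec]; split=> /=; first by split.
  by rewrite Ehd -(nth_mkseq 0 (cells s Queue) lt_hd).
apply: (triple_block_cons (Mid := visiting sd hd next c [::])).
  by apply: triple_wp => s [[Hi [Ehd En] lt_hd Ec] Ecur] /=; rewrite addn1 Ehd.
do 8!(apply: triple_block_cons;
  [apply: visit_triple => [s /fixedE[Ec EW E1 E2]|];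
   [by rewrite /= Ec ?EW ?E1 ?E2; reflexivity | by [apply: fwd|apply: bwd]]|]).
by apply: triple_wp.
Qed.

Lemma pop_triple k :
  triple (fun s => level_inv k s /\ 0 < value (Minus Vtail Vhead) s)
    pop_queue (cost pop_queue) (level_inv k.+1).
Proof.
move=> s [[sd [Hi Hk]] /= Hlt].
have lt_hd : vars s Vhead < vars s Vtail by lia.
have [|t [s' [E le_t H]]] := @visit_neighbours sd (vars s Vhead) (vars s Vnext)
  (nth 0 (queue s) (vars s Vhead)) s; first by split.
exists t, s'; split=> //; exists sd.
case: H => [[Hfl Hfix Hs] [-> En Ec] lt_hd' Enth Hvis]; split; last by lia.
split=> //; apply: (flooding_pop linked_adj) => //; first by rewrite size_mkseq.
move=> j [d Hd adj_j] fg_j; apply: Hvis => //; rewrite -Enth.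
have E' : j = nth 0 (queue s') (vars s Vhead) + d \/
          j = nth 0 (queue s') (vars s Vhead) - d.
  by case: adj_j => E'; [left|right; rewrite E' addnK].
move: Hd; rewrite !inE.
by case/or4P=> /eqP Ed; case: E' => ->; rewrite Ed eqxx ?orbT.
Qed.

Lemma scan_triple k :
  triple (fun s => level_inv k s /\ value (Minus Vtail Vhead) s = 0)
    scan_pixel (cost scan_pixel) (level_inv k.+1).
Proof.
apply: triple_wp => s [[sd [[Hfl Hfix Hs] Hk]] Hlt].
have Hsz : size (queue s) = vars s Vtail by rewrite size_mkseq.
have := head_le Hfl; rewrite Hsz => le_hd.
have Ehd : vars s Vhead = size (queue s) by rewrite Hsz; move: Hlt => /=; lia.
have Elim : vars s Vlimit = lo + S by case: Hfix.
have Eimg : cells s Image = img by case: Hfix.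
have Eodd : vars s Vodd = odd l by case: Hfix.
have Elev : vars s Vlevel = l by case: Hfix.
have := next_range Hfl => Hrange.
rewrite /= Elim; case: ifP => [lt_n|/negbT ge_n]; last first.
  by exists sd; split=> //; right; lia.
have {}lt_n : vars s Vnext < lo + S by lia.
rewrite Eimg; case: ifP => [fg_n|/negbT fgN_n]; last first.
  exists sd; split=> /=; last by rewrite addn1; lia.
  split=> //; rewrite /= addn1; apply: (flooding_skip Hfl) => //.
  by rewrite (negbTE fgN_n).
case: ifP => [lab_n|/negbT labN_n].
  exists sd; split=> /=; last by rewrite addn1; lia.
  by split=> //; rewrite /= addn1; apply: (flooding_skip Hfl).
have lab_n : cells s Label (vars s Vnext) = 0 by lia.
have Hfl' := flooding_seed linked_refl Hfl Ehd lt_n fg_n lab_n.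
exists (rcons sd (vars s Vnext)); split=> /=; last by rewrite addn1; lia.
split.
- rewrite /queue /= !addn1 mkseqS eqxx (@eq_mkseq_lt _ _ (cells s Queue)) //.
  by move=> i lt_i; case: eqP => // Ei; rewrite Ei ltnn in lt_i.
- by rewrite /fixed /=; move: Hfix; rewrite /fixed.
- rewrite level_seeds_rcons catA -Hs /seed_list /= Eodd Elev.
  set g := fun k => (_, _).
  have Eg : mkseq g (vars s Vseeds) = seed_list s.
    apply: eq_mkseq_lt => i lt_i; rewrite /g.
    by case: eqP => // Ei; rewrite Ei ltnn in lt_i.
  case: odd; last by rewrite addn0 cats0.
  by rewrite addn1 mkseqS Eg cats1 /g eqxx.
Qed.

Lemma flood_step_triple k :
  triple (level_inv k) flood_step (cost flood_step) (level_inv k.+1).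
Proof. exact: triple_if (@pop_triple k) (@scan_triple k). Qed.

Definition level_start s :=
  [/\ fixed s = fixed_value, cells s Label = lab0, seed_list s = seeds0,
      vars s Vnext = lo &
      [/\ vars s Vhead = 0, vars s Vtail = 0 & vars s Vcount = 0]].

Definition level_finish s := exists sd,
  [/\ fixed s = fixed_value, seed_list s = seeds0 ++ level_seeds l sd,
      vars s Vcount = size sd /\ size sd <= S,
      level_labelled offsets img linked lo S (cells s Label) sd
    & forall i, ~~ in_level lo S i -> cells s Label i = lab0 i].

(** A level of [S] cells allows at most [S] pops, as queue entries are distinct,
    and at most [S] scans, so [2 * S] steps finish it. *)
Lemma flood_level :
  (forall i, in_level lo S i -> lab0 i = 0) ->
  triple level_start (Repeat (Plus VS VS) flood_step)
    (10 + (S + S) * (cost flood_step + 3)) level_finish.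
Proof.
move=> lab0_0.
have Hrep := triple_repeat (Inv := level_inv) (N := S + S) (e := Plus VS VS) _
  (fun k _ => @flood_step_triple k).
apply: triple_weaken (Hrep _) _ _ _ => //.
- by move=> s [sd [[_ [_ _ ES]]]]; rewrite /= ES.
- move=> s [Hfix Hlab Hs En [Eh Et Ec]]; exists [::].
  rewrite Eh En; split; last by left; rewrite addn0.
  split=> //; last by rewrite /level_seeds if_same cats0.
  by rewrite Hlab Ec En /queue Et; apply: flooding_start.
- move=> s [sd [[Hfl Hfix Hs] Hk]]; exists sd.
  have Hsz : size (queue s) = vars s Vtail by rewrite size_mkseq.
  have le_q := queue_size Hfl; have le_hd := head_le Hfl.
  have Hn := next_range Hfl; have Hc := count_le Hfl.
  have [Eh En] : vars s Vhead = size (queue s) /\ vars s Vnext = lo + S by lia.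
  split=> //.
  + by rewrite (seeds_size Hfl); split=> //; lia.
  + exact: flooding_done Hfl Eh En.
  + exact: other_levels Hfl.
Qed.

End Level.

Definition level_time (S : nat) :=
  cost enter_level +
    (10 + (S + S) * (cost flood_step + 3) + (cost leave_level + 0)).

Definition label_time (L S : nat) :=
  cost start_levels + (7 + L * (level_time S + 3)).

Definition edges_time (seeds : nat) := 7 + seeds * (cost print_seed_edges + 3).

Definition all_seeds (sds : seq (seq nat)) : seq (nat * nat) :=
  flatten [seq level_seeds l (nth [::] sds l.-1) | l <- iota 1 (size sds)].

Lemma all_seeds_rcons sds sd :
  all_seeds (rcons sds sd) = all_seeds sds ++ level_seeds (size sds).+1 sd.
Proof.
rewrite /all_seeds size_rcons -[in LHS](addn1 (size sds)) iotaD map_cat flatten_cat /= cats0 add1n.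
rewrite nth_rcons ltnn eqxx; congr (flatten _ ++ _).
apply/eq_in_map => l; rewrite mem_iota nth_rcons => Hl.
by have -> : l.-1 < size sds by lia.
Qed.

Section Levels.

Variables (N W S d1 d2 : nat) (img : nat -> nat).
Variable linked : nat -> nat -> nat -> Prop.

Let L := N + N - 1.
Let offsets := [:: 1; W; d1; d2].

Hypothesis linked_refl : forall l i, 0 < l <= L ->
  in_level (l * S) S i -> 0 < img i -> linked l i i.
Hypothesis linked_trans : forall l i j k,
  linked l i j -> linked l j k -> linked l i k.
Hypothesis linked_adj : forall l i j, 0 < l <= L ->
  in_level (l * S) S i -> 0 < img i -> adjacent offsets i j -> 0 < img j ->
  in_level (l * S) S j /\ linked l j i.
Hypothesis offsets_le : forall d : nat, d \in offsets -> d <= S.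

Definition constants s :=
  (vars s VN, vars s VW, vars s VS, vars s Vdiag1, vars s Vdiag2,
   vars s Vlevels, vars s Vidx, cells s Image).

Definition labelling (lab : nat -> nat) (sds : seq (seq nat)) :=
  forall l, 0 < l <= size sds ->
    size (nth [::] sds l.-1) <= S /\
    level_labelled offsets img (linked l) (l * S) S lab (nth [::] sds l.-1).

Definition levels_at sds s :=
  [/\ constants s = (N, W, S, d1, d2, L, 0, img),
      [/\ vars s Vlevel = (size sds).+1, vars s Vodd = odd (size sds).+1
        & vars s Vlimit = (size sds).+1 * S],
      printed s = L :: map size sds,
      seed_list s = all_seeds sds
    & labelling (cells s Label) sds /\
      forall i, (size sds).+1 * S <= i -> cells s Label i = 0].

(** The search in one level leaves the labels of the other levels alone, and the
    labels of the levels that follow are still 0. *)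
Lemma label_level_triple sds : size sds < L ->
  triple (levels_at sds) label_level (level_time S)
    (fun s => exists sd, levels_at (rcons sds sd) s).
Proof.
move=> lt_L s0 [Hc [El Eo Elim] Hp Hs [Hlab Hlab0]].
pose l := (size sds).+1; pose lo := l * S; pose lab0 := cells s0 Label.
have l_range : 0 < l <= L by [].
pose start := level_start N W S d1 d2 L img lo l (all_seeds sds)
  (L :: map size sds) lab0.
pose finish := level_finish N W S d1 d2 L img (linked l) lo l (all_seeds sds)
  (L :: map size sds) lab0.
suff H : triple (fun s => s = s0) label_level (level_time S)
    (fun s => exists sd, levels_at (rcons sds sd) s) by apply: H.
apply: (triple_seq (Mid := start)).
  apply: triple_wp => _ ->; split=> //=.
  by move: Hc; rewrite /fixed_value /fixed /= El Eo Elim Hp => -[-> -> -> -> -> -> -> ->];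
    rewrite addnC /lo.
apply: (triple_seq (Mid := finish)).
  apply: flood_level => //.
  - by move=> i; apply: linked_refl.
  - by move=> i j k; apply: linked_trans.
  - by move=> i j; apply: linked_adj.
  - by move=> d /offsets_le le_d; rewrite /lo /l mulSn; lia.
  - by move=> i /andP[le_i _]; apply: Hlab0.
apply: (triple_seq (T2 := 0) (Mid := fun s => exists sd, levels_at (rcons sds sd) s)); last first.
  by apply: triple_wp.
apply: triple_wp => s [sd [Hfix Hs' [Ec le_sd] Hsd Hother]]; exists sd.
move: Hfix; rewrite /fixed /fixed_value => -[EN EW ES E1 E2 EL Elev Eodd Elim' Eidx Eimg Eout].
split=> /=; rewrite ?size_rcons.
- by rewrite /constants /= EN EW ES E1 E2 EL Eidx Eimg.
- rewrite Elev Eodd Elim' addn1 /l /lo; split=> //; last by rewrite mulSn addnC.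
  by rewrite /=; case: (odd (size sds)).
- by rewrite Eout Ec map_rcons rcons_cons.
- by rewrite /seed_list /= -/(seed_list s) Hs' all_seeds_rcons.
- split=> [l' Hl'|i Hi]; last first.
    rewrite Hother; first by apply: Hlab0; lia.
    by rewrite /in_level /lo /l mulSn; lia.
  rewrite size_rcons in Hl'; rewrite nth_rcons.
  case: (ltnP l'.-1 (size sds)) => lt_l'; last first.
    have -> : l'.-1 = size sds by lia.
    by rewrite eqxx; split=> //; have -> : l' = l by rewrite /l; lia.
  have [|le_S Hl] := Hlab l'; first by lia.
  split=> //; apply: level_labelled_ext Hl => [|i].
    by move=> i j; apply: linked_adj; lia.
  case/andP=> _ lt_i; apply: Hother; rewrite /in_level negb_and -ltnNge.
  apply/orP; left; apply: leq_trans lt_i _.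
  by rewrite addnC -mulSn leq_mul2r /l; lia.
Qed.

Definition levels_start s :=
  [/\ (vars s VN, vars s VW, vars s VS, vars s Vdiag1, vars s Vdiag2,
       vars s Vidx, cells s Image) = (N, W, S, d1, d2, 0, img),
      vars s Vseeds = 0, forall i, cells s Label i = 0 & printed s = [::]].

Lemma label_levels_triple :
  triple levels_start label_levels (label_time L S)
    (fun s => exists2 sds, size sds = L & levels_at sds s).
Proof.
apply: (triple_seq (Mid := fun s => exists2 sds, size sds = 0 & levels_at sds s)).
  apply: triple_wp => s [Hc Hs Hlab Hp]; exists [::] => //; split=> /=.
  - by move: Hc; rewrite /constants /= => -[-> -> -> -> -> -> ->].
  - by case: Hc => _ _ -> *; rewrite mul1n.
  - by case: Hc => -> *; rewrite Hp.
  - by rewrite /seed_list /= Hs.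
  - by split=> // l; rewrite /=; lia.
apply: (triple_repeat (e := Vlevels)
  (Inv := fun k s => exists2 sds, size sds = k & levels_at sds s)).
  by move=> s [sds _ [Hc _ _ _ _]]; case: Hc.
move=> k lt_k s [sds Esz Hs]; subst k.
have [t [s' [E le_t [sd Hsd]]]] := label_level_triple lt_k Hs.
by exists t, s'; split=> //; exists (rcons sds sd); rewrite ?size_rcons.
Qed.

End Levels.

(** ** Printing the edges *)

Definition seed_edges (S L : nat) (lab : nat -> nat) (li : nat * nat) : seq edge_code :=
  let: (l, i) := li in
  (if 0 < l - 1 then [:: ((l, lab i), (l - 1, lab (i - S)))] else [::]) ++
  (if 0 < L - l then [:: ((l, lab i), (l + 1, lab (i + S)))] else [::]).

Definition edge_numbers (e : edge_code) := [:: e.1.1; e.1.2; e.2.1; e.2.2].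

Lemma print_edges_triple S L lab seeds out :
  triple (fun s => [/\ vars s VS = S, vars s Vlevels = L, vars s Vidx = 0,
                       cells s Label = lab & seed_list s = seeds /\ printed s = out])
    print_edges (edges_time (size seeds))
    (fun s => printed s = out ++ flatten [seq edge_numbers e |
                e <- flatten [seq seed_edges S L lab li | li <- seeds]]).
Proof.
pose Inv k s := [/\ vars s VS = S, vars s Vlevels = L, vars s Vidx = k,
    cells s Label = lab & seed_list s = seeds /\
    printed s = out ++ flatten [seq edge_numbers e |
                e <- flatten [seq seed_edges S L lab li | li <- take k seeds]]].
apply: triple_weaken (triple_repeat (Inv := Inv) (N := size seeds) _ _) _ _ _.
- by move=> s [_ _ _ _ [<- _]]; rewrite size_mkseq.
- move=> k lt_k; apply: triple_wp => s [ES EL Ei Elab [Es Ep]].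
  have Ek : (cells s SeedLevel k, cells s SeedIndex k) = nth (0, 0) seeds k.
    by rewrite -Es nth_mkseq // -(size_mkseq (fun k => (cells s SeedLevel k,
      cells s SeedIndex k)) (vars s Vseeds)) -/(seed_list s) Es.
  rewrite /Inv (take_nth (0, 0)) // map_rcons -cats1 flatten_cat map_cat flatten_cat.
  rewrite -Ek /= cats0.
  case E1: (0 < cells s SeedLevel k - 1);
    case E2: (0 < L - cells s SeedLevel k);
    rewrite /= Ei ES EL Elab ?E1 ?E2 /= ?addn1; do 2!split=> //;
    rewrite Ep -?cats1 -?catA ?cats0 //.
- by move=> s [? ? ? ? [? Hp]]; rewrite /Inv take0 cats0.
- by [].
- by move=> s [_ _ _ _ [_]]; rewrite take_size.
Qed.

(** * Reading the video *)

Definition add_to (f : nat -> nat) q b j := if j == q then f q + b else f j.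

Lemma add_to_gt0 f q b j :
  (0 < add_to f q b j) = (0 < f j) || ((0 < b) && (j == q)).
Proof.
rewrite /add_to; case: eqP => [->|_]; first by rewrite addn_gt0 andbT.
by rewrite andbF orbF.
Qed.

Lemma iota0S k : iota 0 k.+1 = rcons (iota 0 k) k.
Proof. by rewrite -addn1 iotaD cats1. Qed.

Section Reading.

Variables (n w h code : nat) (v : nat * nat * nat -> nat).

Let W := w + 1.
Let S := h.+1 * W.
Let d1 := if 4 < code then w else 1.
Let d2 := if 4 < code then W + 1 else W.

Definition read_time :=
  cost read_header +
  (9 + h.+1 * (cost (Assign VS (Plus VS VW)) + 3) +
  (cost set_offsets +
    (7 + n * (7 + h * (7 + w * (cost read_pixel + 3) +
      cost (Assign Vpos (Plus Vpos 1)) + 3) +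
      cost (Assign Vpos (Plus Vpos (Plus VS VW))) + 3)))).

(** The cell of the pixel in row [y] and column [x], counted from 0, of level [l].
    A level occupies [S = (h + 1) * W] cells in rows of width [W = w + 1]; its
    first row and its first column are background. *)
Definition pixel_index (W S l y x : nat) := l * S + y.+1 * W + x.+1.

Definition pixel_hits (t : nat * nat * nat) (i : nat) :=
  let p := pixel_index W S t.1.1.*2.+1 t.1.2 t.2 in
  [|| i == p, i == p + S | i == p - S].

(** Only positivity matters: a pixel that is set in two consecutive frames counts
    twice in their union. *)
Definition drawn (pixels : seq (nat * nat * nat)) (img : nat -> nat) :=
  forall i, (0 < img i) = has (fun t => (0 < v t) && pixel_hits t i) pixels.

Definition row_pixels k (f y : nat) := [seq (f, y, x) | x <- iota 0 k].
Definition frame_pixels k f := flatten [seq row_pixels w f y | y <- iota 0 k].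
Definition video_pixels k := flatten [seq frame_pixels h f | f <- iota 0 k].

Definition header_constants s :=
  (vars s VN, vars s Vw, vars s Vh, vars s VW, vars s VS, vars s Vdiag1,
   vars s Vdiag2, vars s Vidx, vars s Vseeds, cells s Label, printed s).

Definition reading pixels pos rest s :=
  [/\ header_constants s = (n, w, h, W, S, d1, d2, 0, 0, fun=> 0, [::]),
      vars s Vpos = pos, unread s = rest & drawn pixels (cells s Image)].

Lemma read_pixel_triple pixels f y x rest :
  triple (reading pixels (pixel_index W S f.*2.+1 y x) (v (f, y, x) :: rest))
    read_pixel (cost read_pixel)
    (reading (rcons pixels (f, y, x)) (pixel_index W S f.*2.+1 y x.+1) rest).
Proof.
apply: triple_wp => s [Hc Hpos Hrest Hd] /=.
have ES : vars s VS = S by case: Hc.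
rewrite Hrest /= Hpos ES; split=> //=; first by rewrite /pixel_index; lia.
move=> i; set p := pixel_index _ _ _ _ _.
transitivity (0 < add_to (add_to (add_to (cells s Image) p (v (f, y, x)))
  (p + S) (v (f, y, x))) (p - S) (v (f, y, x)) i); first by [].
rewrite !add_to_gt0 has_rcons -Hd /pixel_hits /= -/p.
by case: (0 < v (f, y, x)); rewrite /= ?orbF // [RHS]orbC !orbA.
Qed.

Lemma read_row_triple pixels f y rest :
  triple (reading pixels (pixel_index W S f.*2.+1 y 0)
           (map v (row_pixels w f y) ++ rest))
    read_row (7 + w * (cost read_pixel + 3) + cost (Assign Vpos (Plus Vpos 1)))
    (reading (pixels ++ row_pixels w f y) (pixel_index W S f.*2.+1 y.+1 0) rest).
Proof.
pose Inv k := reading (pixels ++ row_pixels k f y) (pixel_index W S f.*2.+1 y k)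
  ([seq v (f, y, x) | x <- iota k (w - k)] ++ rest).
apply: (triple_seq (Mid := Inv w)).
  apply: triple_weaken (triple_repeat (Inv := Inv) (N := w) _ _) _ _ _ => //.
  - by move=> s [Hc _ _ _]; case: Hc.
  - move=> k lt_k; rewrite /Inv.
    have -> : w - k = (w - k.+1).+1 by lia.
    by rewrite /row_pixels iota0S map_rcons -rcons_cat; apply: read_pixel_triple.
  - by move=> s; rewrite /Inv cats0 subn0 -map_comp.
apply: triple_wp => s [Hc Hpos Hrest Hd]; split=> //=.
- by rewrite Hpos /pixel_index /W; lia.
- by rewrite Hrest subnn.
Qed.

Lemma read_frame_triple pixels f rest :
  triple (reading pixels (pixel_index W S f.*2.+1 0 0)
           (map v (frame_pixels h f) ++ rest))
    read_frame (7 + h * (7 + w * (cost read_pixel + 3) +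
      cost (Assign Vpos (Plus Vpos 1)) + 3) +
      cost (Assign Vpos (Plus Vpos (Plus VS VW))))
    (reading (pixels ++ frame_pixels h f) (pixel_index W S f.+1.*2.+1 0 0) rest).
Proof.
pose Inv k := reading (pixels ++ frame_pixels k f) (pixel_index W S f.*2.+1 k 0)
  (map v (flatten [seq row_pixels w f y | y <- iota k (h - k)]) ++ rest).
apply: (triple_seq (Mid := Inv h)).
  apply: triple_weaken (triple_repeat (Inv := Inv) (N := h) _ _) _ _ _ => //.
  - by move=> s [Hc _ _ _]; case: Hc.
  - move=> k lt_k; rewrite /Inv.
    have -> : h - k = (h - k.+1).+1 by lia.
    rewrite /frame_pixels iota0S map_rcons flatten_rcons catA [iota k _.+1]/=.
    by rewrite map_cons [flatten (_ :: _)]/= map_cat -catA; apply: read_row_triple.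
  - by move=> s; rewrite /Inv cats0 subn0.
apply: triple_wp => s [Hc Hpos Hrest Hd]; split=> //=.
- have [-> ->] : vars s VS = S /\ vars s VW = W by case: Hc.
  by rewrite Hpos /pixel_index doubleS !mulSn mul0n; have : S = W + h * W by []; lia.
- by rewrite Hrest subnn.
Qed.

Lemma read_video_triple rest :
  triple (reading [::] (pixel_index W S 1 0 0) (map v (video_pixels n) ++ rest))
    (Repeat VN read_frame)
    (7 + n * (7 + h * (7 + w * (cost read_pixel + 3) +
      cost (Assign Vpos (Plus Vpos 1)) + 3) +
      cost (Assign Vpos (Plus Vpos (Plus VS VW))) + 3))
    (fun s => reading (video_pixels n) (pixel_index W S n.*2.+1 0 0) rest s).
Proof.
pose Inv k := reading (video_pixels k) (pixel_index W S k.*2.+1 0 0)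
  (map v (flatten [seq frame_pixels h f | f <- iota k (n - k)]) ++ rest).
apply: triple_weaken (triple_repeat (Inv := Inv) (N := n) _ _) _ _ _ => //.
- by move=> s [Hc _ _ _]; case: Hc.
- move=> k lt_k; rewrite /Inv.
  have -> : n - k = (n - k.+1).+1 by lia.
  rewrite /video_pixels iota0S map_rcons flatten_rcons [iota k _.+1]/=.
  by rewrite map_cons [flatten (_ :: _)]/= map_cat -catA; apply: read_frame_triple.
- by move=> s; rewrite /Inv subn0.
- by move=> s; rewrite /Inv subnn.
Qed.

Lemma read_frames_triple :
  triple (eq (blank_state ([:: n; w; h; code] ++ map v (video_pixels n))))
    read_frames read_time
    (fun s => exists2 img, drawn (video_pixels n) img &
                levels_start n W S d1 d2 img s).
Proof.
pose header k s :=
  [/\ (vars s VN, vars s Vw, vars s Vh, vars s VK, vars s VW, vars s VS) =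
        (n, w, h, code, W, k * W),
      (vars s Vidx, vars s Vseeds, cells s Label, cells s Image, printed s) =
        (0, 0, fun=> 0, fun=> 0, [::])
    & unread s = map v (video_pixels n)].
apply: (triple_seq (Mid := header 0)).
  by apply: triple_wp => _ <-.
apply: (triple_seq (Mid := header h.+1)).
  apply: triple_weaken (triple_repeat (Inv := header) (N := h.+1) _ _) _ _ _ => //.
  - by move=> s [Hc _ _]; case: Hc => /= _ _ -> *; rewrite addn1.
  - move=> k _; apply: triple_wp => s [Hc Hc' Hr]; split=> //=.
    by case: Hc => -> -> -> -> -> ->; rewrite mulSn addnC.
apply: (triple_seq (Mid := reading [::] (pixel_index W S 1 0 0)
    (map v (video_pixels n) ++ [::]))).
  apply: triple_wp => s [Hc Hc' Hr] /=.
  have [EW ES EK Ew] : [/\ vars s VW = W, vars s VS = S, vars s VK = code & vars s Vw = w].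
    by case: Hc.
  rewrite EK subn_gt0; case: ifP => Hcode;
    (split; rewrite ?cats0 //=;
     [by move: Hc Hc'; rewrite /header_constants /= EW ES Ew /d1 /d2 Hcode
         => -[-> -> _] [-> -> -> _ ->]
     |by rewrite EW ES /pixel_index; lia
     |by move=> i /=; case: Hc' => _ _ _ -> _]).
apply: triple_weaken (@read_video_triple [::]) _ _ _ => //.
move=> s [Hc _ _ Hd]; exists (cells s Image) => //.
rewrite /levels_start; case: Hc => -> _ _ -> -> -> -> -> -> -> ->.
by split.
Qed.

End Reading.

(** * Geometry of the padded stack of images *)

Definition touching (k : connectivity) (x y x' y' : nat) : bool :=
  match k with
  | Conn8 => [&& x <= x'.+1, x' <= x.+1, y <= y'.+1 & y' <= y.+1]
  | Conn4 => ((x == x') && (y <= y'.+1) && (y' <= y.+1)) ||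
             ((y == y') && (x <= x'.+1) && (x' <= x.+1))
  end.

Lemma touching_sym k x y x' y' : touching k x y x' y' = touching k x' y' x y.
Proof. by case: k => /=; apply/idP/idP; lia. Qed.

Section Geometry.

Variables (w h W S : nat).
Hypotheses (EW : W = w + 1) (ES : S = h.+1 * W).

(** Uniqueness of quotient and remainder. *)
Lemma digits B a b a' b' : b < B -> b' < B -> a * B + b = a' * B + b' ->
  a = a' /\ b = b'.
Proof.
move=> lt_b lt_b' E; have B_gt0 : 0 < B by apply: leq_ltn_trans lt_b.
have Ea : a = a'.
  by have := congr1 (divn^~ B) E; rewrite !divnMDl // !divn_small // !addn0.
by split=> //; move: E; rewrite Ea => /addnI.
Qed.

Lemma pixel_indexE l y x : pixel_index W S l y x = (l * h.+1 + y.+1) * W + x.+1.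
Proof. by rewrite /pixel_index ES mulnDl mulnA. Qed.

(** The row 0 and the column 0 of a level contain no pixel, so a step that would
    leave the rectangle never ends at a pixel. *)
Lemma pixel_index_shift l y l' y' x' dy b :
  x' < w -> y < h -> y' < h -> dy <= 1 -> b < W ->
  pixel_index W S l' y' x' = (l * h.+1 + y.+1 + dy) * W + b ->
  [/\ l' = l, y' = y + dy & x'.+1 = b].
Proof.
move=> lt_x' lt_y lt_y' le_dy lt_b; rewrite pixel_indexE => E.
have [|//|Ea <-] := digits _ _ E; first by lia.
have [Eh|neq_h] := eqVneq (y.+1 + dy) h.+1.
  have : l' * h.+1 + y'.+1 = l.+1 * h.+1 + 0 by rewrite mulSn; lia.
  by case/digits => //; lia.
have : l' * h.+1 + y'.+1 = l * h.+1 + (y.+1 + dy) by lia.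
by case/digits; [lia|lia|move=> -> ?; split=> //; lia].
Qed.

Lemma pixel_index_inj l y x l' y' x' :
  x < w -> x' < w -> y < h -> y' < h ->
  pixel_index W S l' y' x' = pixel_index W S l y x -> [/\ l' = l, y' = y & x' = x].
Proof.
move=> lt_x lt_x' lt_y lt_y' E.
have [|||-> -> [->]] := @pixel_index_shift l y l' y' x' 0 x.+1 lt_x' lt_y lt_y'.
- by [].
- by lia.
- by rewrite addn0 -pixel_indexE.
- by rewrite addn0.
Qed.

Lemma pixel_index_level l y x : x < w -> y < h -> in_level (l * S) S (pixel_index W S l y x).
Proof.
move=> lt_x lt_y; rewrite /in_level /pixel_index -addnA leq_addr ltn_add2l /=.
apply: (@leq_ltn_trans (h * W + x.+1)); first by rewrite leq_add2r leq_mul2r lt_y orbT.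
by rewrite addnC ES mulSn ltn_add2r EW; lia.
Qed.

Variable k : connectivity.

Let d1 := if 4 < conn_code k then w else 1.
Let d2 := if 4 < conn_code k then W + 1 else W.
Let offsets := [:: 1; W; d1; d2].

Lemma pixel_index_step l y x l' y' x' d :
  x < w -> x' < w -> y < h -> y' < h -> d \in offsets ->
  pixel_index W S l' y' x' = pixel_index W S l y x + d ->
  l' = l /\ touching k x y x' y'.
Proof.
move=> lt_x lt_x' lt_y lt_y' Hd; rewrite [pixel_index _ _ l y x]pixel_indexE => E.
have shift dy b (Eb : pixel_index W S l' y' x' = (l * h.+1 + y.+1 + dy) * W + b)
    (le_dy : dy <= 1) (lt_b : b < W) :=
  pixel_index_shift lt_x' lt_y lt_y' le_dy lt_b Eb.
have [Ed|[Ed|[[Ek Ed]|[Ek Ed]]]] :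
    d = 1 \/ d = W \/ (k = Conn8 /\ d = w) \/ (k = Conn8 /\ d = W + 1).
  by move: Hd; rewrite /offsets !inE /d1 /d2; case: (k) => /= /or4P[] /eqP ->; tauto.
- have [Ex|neq_x] := eqVneq x.+2 W.
    have E1 : pixel_index W S l' y' x' = (l * h.+1 + y.+1 + 1) * W + 0.
      by rewrite E Ed (mulnDl _ 1) mul1n; lia.
    by have [||_ _] := shift _ _ E1; lia.
  have E1 : pixel_index W S l' y' x' = (l * h.+1 + y.+1 + 0) * W + x.+2.
    by rewrite E Ed; lia.
  have [||-> Ey Ex'] := shift _ _ E1; [lia|lia|].
  by split=> //; case: (k) => /=; lia.
- have E1 : pixel_index W S l' y' x' = (l * h.+1 + y.+1 + 1) * W + x.+1.
    by rewrite E Ed (mulnDl _ 1) mul1n; lia.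
  have [||-> Ey Ex'] := shift _ _ E1; [lia|lia|].
  by split=> //; case: (k) => /=; lia.
- have E1 : pixel_index W S l' y' x' = (l * h.+1 + y.+1 + 1) * W + x.
    by rewrite E Ed (mulnDl _ 1) mul1n; lia.
  have [||-> Ey Ex'] := shift _ _ E1; [lia|lia|].
  by split=> //; rewrite Ek /=; lia.
- have [Ex|neq_x] := eqVneq x.+2 W.
    have E2 : pixel_index W S l' y' x' = (l * h.+1 + y.+1 + 2) * W + 0.
      by rewrite E Ed (mulnDl _ 2); lia.
    by move: E2; rewrite pixel_indexE => /digits[]; lia.
  have E1 : pixel_index W S l' y' x' = (l * h.+1 + y.+1 + 1) * W + x.+2.
    by rewrite E Ed (mulnDl _ 1) mul1n; lia.
  have [||-> Ey Ex'] := shift _ _ E1; [lia|lia|].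
  by split=> //; rewrite Ek /=; lia.
Qed.

Lemma pixel_index_adjacent l y x l' y' x' :
  x < w -> x' < w -> y < h -> y' < h ->
  adjacent offsets (pixel_index W S l y x) (pixel_index W S l' y' x') ->
  l' = l /\ touching k x y x' y'.
Proof.
move=> lt_x lt_x' lt_y lt_y' [d Hd [/pixel_index_step|/pixel_index_step]].
  by apply.
by rewrite touching_sym => H; case: H => // ->.
Qed.

Lemma touching_adjacent l y x y' x' :
  touching k x y x' y' ->
  (x = x' /\ y = y') \/
  adjacent offsets (pixel_index W S l y x) (pixel_index W S l y' x').
Proof.
have wlog_y : forall y x y' x', y <= y' -> touching k x y x' y' ->
    (x = x' /\ y = y') \/
    adjacent offsets (pixel_index W S l y x) (pixel_index W S l y' x').
  move=> {}y {}x {}y' {}x' le_y Hnear.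
  have Edir : (y' = y /\ (x' = x \/ x' = x.+1 \/ x = x'.+1)) \/
      (y' = y.+1 /\ (x' = x \/ 4 < conn_code k /\ (x' = x.+1 \/ x = x'.+1))).
    by move: Hnear; case: (k) => /=; lia.
  case: Edir => [[-> [->|[->|->]]]|[-> [->|[Ek [->|->]]]]]; [by left|right..].
  - by exists 1; rewrite ?inE //; left; rewrite /pixel_index; lia.
  - by exists 1; rewrite ?inE //; right; rewrite /pixel_index; lia.
  - by exists W; rewrite ?inE ?eqxx ?orbT //; left; rewrite /pixel_index !mulSn; lia.
  - exists d2; rewrite ?inE ?eqxx ?orbT //; left.
    by rewrite /d2 Ek /= /pixel_index !mulSn; lia.
  - exists d1; rewrite ?inE ?eqxx ?orbT //; left.
    by rewrite /d1 Ek /= /pixel_index !mulSn EW; lia.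
move=> Hnear; case: (leqP y y') => [le_y|/ltnW le_y]; first exact: wlog_y.
rewrite touching_sym in Hnear; have [[-> ->]|] := wlog_y _ _ _ _ le_y Hnear; first by left.
by move=> Hadj; right; apply: adjacent_sym.
Qed.

End Geometry.

(** * The program computes a labelling of all levels *)

Definition pixel_graph (k : connectivity) (w h : nat) (I : binary_image w h) :
    rel ('I_w * 'I_h) :=
  fun p q => [&& I p, I q & touching k p.1 p.2 q.1 q.2].

Definition pixel_connect k w h (I : binary_image w h) := connect (pixel_graph k I).

Lemma pixel_connect_sym k w h (I : binary_image w h) :
  connect_sym (pixel_graph k I).
Proof.
by apply: sym_connect_sym => p q; rewrite /pixel_graph touching_sym andbCA.
Qed.

Lemma pixel_connect_sub k w h (I J : binary_image w h) p q :
  (forall p, I p -> J p) -> pixel_connect k I p q -> pixel_connect k J p q.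
Proof.
move=> IJ; apply: connect_sub => {}p {}q /and3P[Ip Iq Hnear].
by apply: connect1; rewrite /pixel_graph !IJ.
Qed.

(** The combinatorial form of the merge graph: components are those of the pixel
    graph, [lab l p] is the number of the component of the pixel [p] at level [l],
    and every edge comes from a pixel that is lit at its source. *)
Definition pixel_merge_graph n w h (V : video n w h) (out : seq nat) :=
  exists (m : seq nat) (lab : nat -> 'I_w * 'I_h -> nat) (es : seq edge_code),
  [/\ size m = n.*2.-1 /\ out = encode_graph m es,
      forall l p, level n l -> level_image V l p -> 1 <= lab l p <= nth 0 m l.-1,
      forall l a, level n l -> 1 <= a <= nth 0 m l.-1 ->
        exists2 p, level_image V l p & lab l p = a,
      forall l p q, level n l -> level_image V l p -> level_image V l q ->
        (lab l p = lab l q <-> pixel_connect (conn V) (level_image V l) p q)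
    & uniq es /\ forall l a l' b, ((l, a), (l', b)) \in es <->
        [/\ level n l, level n l', arrow l l' &
         exists p, [/\ level_image V l p, lab l p = a & lab l' p = b]]].

Lemma level_image_sub n w h (V : video n w h) l l' p :
  arrow l l' -> level_image V l p -> level_image V l' p.
Proof.
rewrite /level_image => /andP[Hodd /orP[]/eqP E].
  by rewrite Hodd E /= Hodd ffunE uphalf_half Hodd add1n /= => ->.
move: Hodd; rewrite E /= => /negbTE Ho; rewrite uphalf_half Ho ffunE => ->.
by rewrite orbT.
Qed.

Section Video.

Variables (n w h : nat) (V : video n w h).

Definition pixel_value (t : nat * nat * nat) : nat :=
  if (insub t.2, insub t.1.2) is (Some i, Some j) then frame V t.1.1 (i, j)
  else 0.

Lemma pixel_valueE f (p : 'I_w * 'I_h) :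
  pixel_value (f, val p.2, val p.1) = frame V f p.
Proof. by rewrite /pixel_value /= !valK; case: p. Qed.

Lemma encode_videoE :
  encode_video V =
  [:: n; w; h; conn_code (conn V)] ++ map pixel_value (video_pixels w h n).
Proof.
congr (_ ++ _); rewrite /video_pixels map_flatten -map_comp.
have -> : frames V = [seq frame V f | f <- iota 0 n] :> seq _.
  by rewrite -[LHS](mkseq_nth [ffun=> false]) size_tuple.
rewrite -map_comp; congr flatten; apply: eq_map => f /=.
rewrite /encode_image /frame_pixels map_flatten -map_comp.
rewrite -(val_enum_ord h) -map_comp; congr flatten; apply: eq_map => j /=.
rewrite /row_pixels -(val_enum_ord w) -!map_comp; apply: eq_map => i /=.
by rewrite -(pixel_valueE f (i, j)).
Qed.

Lemma mem_video_pixels f y x :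
  ((f, y, x) \in video_pixels w h n) = [&& f < n, y < h & x < w].
Proof.
apply/flattenP/and3P => [[_ /mapP[f' Hf ->] /flattenP[_ /mapP[y' Hy ->]]]|].
  by case/mapP=> x' Hx [-> -> ->]; rewrite !mem_iota in Hf Hy Hx.
case=> lt_f lt_y lt_x; exists (frame_pixels w h f).
  by apply/map_f; rewrite mem_iota.
apply/flattenP; exists (row_pixels w f y); first by apply/map_f; rewrite mem_iota.
by apply/mapP; exists x; rewrite ?mem_iota.
Qed.

Let k := conn V.
Let W := w + 1.
Let S := h.+1 * W.
Let d1 := if 4 < conn_code k then w else 1.
Let d2 := if 4 < conn_code k then W + 1 else W.
Let offsets := [:: 1; W; d1; d2].

Definition index_of (l : nat) (p : 'I_w * 'I_h) := pixel_index W S l p.2 p.1.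

Lemma index_of_inj l l' p q : index_of l p = index_of l' q -> l = l' /\ p = q.
Proof.
move/(@pixel_index_inj w h W S erefl erefl); case=> // -> Ey Ex; split=> //.
by case: p q Ey Ex => [i j] [i' j'] /= /val_inj -> /val_inj ->.
Qed.

Lemma index_of_level l p : in_level (l * S) S (index_of l p).
Proof. exact: (@pixel_index_level w h). Qed.

Lemma in_level_eq l l' i :
  in_level (l * S) S i -> in_level (l' * S) S i -> l = l'.
Proof.
case/andP=> H1 H2 /andP[H3 H4]; rewrite addnC -mulSn in H2; rewrite addnC -mulSn in H4.
have := leq_ltn_trans H1 H4; have := leq_ltn_trans H3 H2.
by rewrite !ltn_mul2r => /andP[_ ?] /andP[_ ?]; lia.
Qed.

Lemma offsets_le : 0 < w -> 0 < h -> forall d : nat, d \in offsets -> d <= S.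
Proof.
move=> w_gt0 h_gt0 d; rewrite !inE => Hd.
have le_d : d <= W + 1.
  by move: Hd; rewrite /d1 /d2 /W; case: (4 < _) => /or4P[] /eqP ->; lia.
apply: leq_trans le_d _; rewrite /S mulSn leq_add2l.
by rewrite muln_gt0 h_gt0 /W addn1.
Qed.

Section Drawn.

Variable img : nat -> nat.
Hypothesis Hd : drawn w h pixel_value (video_pixels w h n) img.

Lemma drawnP i :
  reflect (exists f p, [/\ f < n, frame V f p &
             [\/ i = index_of f.*2.+1 p, i = index_of f.*2.+2 p
               | i = index_of f.*2 p]])
          (0 < img i).
Proof.
have hitsP f (p : 'I_w * 'I_h) : pixel_hits w h (f, val p.2, val p.1) i <->
    [\/ i = index_of f.*2.+1 p, i = index_of f.*2.+2 p | i = index_of f.*2 p].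
  have E1 : index_of f.*2.+2 p = index_of f.*2.+1 p + S.
    by rewrite /index_of /pixel_index [_.+2 * _]mulSn; lia.
  have E2 : index_of f.*2 p = index_of f.*2.+1 p - S.
    by rewrite /index_of /pixel_index mulSn; lia.
  by rewrite E1 E2; split=> [/or3P[] /eqP ->|[] ->];
    [constructor 1|constructor 2|constructor 3|rewrite /pixel_hits..];
    rewrite ?eqxx ?orbT.
rewrite Hd; apply: (iffP hasP) => [[[[f y] x]]|[f [p [lt_f Hf Hi]]]].
  rewrite mem_video_pixels => /and3P[lt_f lt_y lt_x] /andP[].
  rewrite -[y]/(val (Ordinal lt_y)) -[x]/(val (Ordinal lt_x)).
  rewrite (pixel_valueE f (Ordinal lt_x, Ordinal lt_y)) lt0b => Hf /(hitsP f (Ordinal lt_x, Ordinal lt_y)) Hi.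
  by exists f, (Ordinal lt_x, Ordinal lt_y).
exists (f, val p.2, val p.1); first by rewrite mem_video_pixels lt_f !ltn_ord.
by rewrite pixel_valueE lt0b Hf; apply/hitsP.
Qed.

(** The array holds at every level the image of the diagram, the unions
    included. *)
Lemma img_index l p : level n l -> (0 < img (index_of l p)) = level_image V l p.
Proof.
move=> Hl; have El := odd_double_half l.
apply/drawnP/idP => [[f [q [lt_f Hf Hi]]]|].
  have {Hi}[Hl' Epq] : [\/ l = f.*2.+1, l = f.*2.+2 | l = f.*2] /\ p = q.
    by case: Hi => /index_of_inj[-> ->]; split=> //; [constructor 1|constructor 2|constructor 3].
  subst q; rewrite /level_image; case: Hl' => El'.
  - by rewrite El' /= odd_double /= uphalf_double.
  - by rewrite El' /= odd_double /= doubleK ffunE Hf.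
  - by rewrite El' odd_double doubleK ffunE Hf orbT.
rewrite /level_image; move: El Hl; rewrite /level; case: odd => El Hl.
  move=> Hp; exists l./2, p; split=> //; first by lia.
  by constructor 1; congr index_of; lia.
rewrite ffunE => /orP[] Hp.
  exists l./2.-1, p; split=> //; first by lia.
  by constructor 2; congr index_of; lia.
exists l./2, p; split=> //; first by lia.
by constructor 3; congr index_of; lia.
Qed.

Lemma img_index_inv l i : in_level (l * S) S i -> 0 < img i ->
  exists p, i = index_of l p.
Proof.
move=> Hi /drawnP[f [p [_ _ Hip]]]; exists p.
case: Hip Hi => -> Hi; congr index_of; apply: in_level_eq (index_of_level _ p) Hi.
Qed.

Definition linked l i j :=
  exists p q, [/\ i = index_of l p, j = index_of l q &
                  pixel_connect k (level_image V l) p q].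

Let level_gt0 l : 0 < l <= n + n - 1 -> level n l.
Proof. by rewrite /level addnn subn1. Qed.

Lemma linked_refl l i : 0 < l <= n + n - 1 ->
  in_level (l * S) S i -> 0 < img i -> linked l i i.
Proof.
move=> /level_gt0 Hl lev_i fg_i; have [p Ep] := img_index_inv lev_i fg_i.
by exists p, p; split=> //; apply: connect0.
Qed.

Lemma linked_trans l i j m : linked l i j -> linked l j m -> linked l i m.
Proof.
move=> [p [q [-> -> Hpq]]] [q' [r [/index_of_inj[_ <-] -> Hqr]]].
by exists p, r; split=> //; apply: connect_trans Hpq Hqr.
Qed.

Lemma linked_adj l i j : 0 < l <= n + n - 1 ->
  in_level (l * S) S i -> 0 < img i -> adjacent offsets i j -> 0 < img j ->
  in_level (l * S) S j /\ linked l j i.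
Proof.
move=> /level_gt0 Hl lev_i fg_i adj_ij fg_j.
have [p Ep] := img_index_inv lev_i fg_i.
have [l' [q Eq]] : exists l' q, j = index_of l' q.
  by case/drawnP: fg_j => f [q [_ _ []->]]; do 2!eexists.
move: adj_ij; rewrite Ep Eq => /(@pixel_index_adjacent w h W S erefl erefl).
case=> // El Hnear; subst l'; split; first exact: index_of_level.
exists q, p; split=> //; apply: connect1.
by rewrite /pixel_graph -!img_index // -Ep -Eq fg_i fg_j touching_sym.
Qed.

Section Output.

Variables (lab : nat -> nat) (sds : seq (seq nat)).
Hypothesis size_sds : size sds = n + n - 1.
Hypothesis Hlab : labelling W S d1 d2 img linked lab sds.

Let m := map size sds.
Let seeds l := nth [::] sds l.-1.
Let plab l p := lab (index_of l p).

Let Hlevel l : level n l -> level_labelled offsets img (linked l) (l * S) S lab (seeds l).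
Proof. by move=> Hl; apply: (Hlab _).2; rewrite size_sds addnn subn1. Qed.

Let nth_m l : level n l -> nth 0 m l.-1 = size (seeds l).
Proof.
by move=> Hl; rewrite (nth_map [::]) // size_sds; move: Hl; rewrite /level; lia.
Qed.

Lemma seed_pixel l a : level n l -> a < size (seeds l) ->
  exists p, [/\ nth 0 (seeds l) a = index_of l p, level_image V l p & plab l p = a.+1].
Proof.
move=> Hl lt_a; have [H _ _] := Hlevel Hl; have [lev_i fg_i lab_i] := H _ lt_a.
have [p Ep] := img_index_inv lev_i fg_i.
by exists p; rewrite /plab -Ep -img_index // -Ep.
Qed.

Lemma plab_range l p : level n l -> level_image V l p ->
  1 <= plab l p <= size (seeds l).
Proof.
move=> Hl Hp; have [_ H _] := Hlevel Hl.
by case: (H _ (index_of_level l p)) => //; rewrite img_index.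
Qed.

Lemma plab_seed l p : level n l -> level_image V l p ->
  exists q, [/\ nth 0 (seeds l) (plab l p).-1 = index_of l q, level_image V l q,
                plab l q = plab l p & pixel_connect k (level_image V l) p q].
Proof.
move=> Hl Hp; have Hr := plab_range Hl Hp.
have [|q [Eq Hq lab_q]] := @seed_pixel l (plab l p).-1 Hl; first by lia.
exists q; split=> //; first by rewrite lab_q; lia.
have [_ H _] := Hlevel Hl; case: (H _ (index_of_level l p)); first by rewrite img_index.
move=> _ [p' [q' [/index_of_inj[_ <-]]]].
by rewrite -/(plab l p) Eq => /index_of_inj[_ <-].
Qed.

Lemma plab_connect l p q : level n l -> level_image V l p -> level_image V l q ->
  plab l p = plab l q <-> pixel_connect k (level_image V l) p q.
Proof.
move=> Hl Hp Hq; split=> [E|].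
  have [r [Er _ _ Cr]] := plab_seed Hl Hp; have [r' [Er' _ _ Cr']] := plab_seed Hl Hq.
  rewrite E Er' in Er; case: (index_of_inj Er) => _ Err; rewrite Err in Cr'.
  by apply: connect_trans Cr _; rewrite /pixel_connect pixel_connect_sym.
case/connectP=> path Hpath ->; elim: path p Hp Hpath => //= r path IH p Hp.
case/andP=> /and3P[_ Hr Hnear] Hpath; rewrite -(IH r Hr Hpath).
have [_ _ H] := Hlevel Hl.
have [[E1 E2]|Hadj] := @touching_adjacent w h W S erefl erefl k l _ _ _ _ Hnear.
  by congr plab; case: (p) (r) E1 E2 => [? ?] [? ?] /= /val_inj -> /val_inj ->.
by apply: H Hadj _; rewrite ?index_of_level // img_index.
Qed.

Let es := flatten [seq seed_edges S (n + n - 1) lab li | li <- all_seeds sds].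

Lemma mem_all_seeds l i :
  ((l, i) \in all_seeds sds) = [&& level n l, odd l & i \in seeds l].
Proof.
apply/flattenP/and3P => [[_ /mapP[l' Hl' ->]]|[Hl Hodd Hi]].
  rewrite mem_iota size_sds in Hl'.
  rewrite /level_seeds; case: ifP => // Hodd /mapP[i' Hi' [-> ->]].
  by split=> //; rewrite /level; lia.
exists (level_seeds l (seeds l)).
  apply/mapP; exists l => //; rewrite mem_iota size_sds.
  by move: Hl; rewrite /level; lia.
by rewrite /level_seeds Hodd map_f.
Qed.

Lemma uniq_flatten_map (A B : eqType) (f : A -> seq B) (s : seq A) :
  uniq s -> (forall x, x \in s -> uniq (f x)) ->
  (forall x y b, x \in s -> y \in s -> b \in f x -> b \in f y -> x = y) ->
  uniq (flatten (map f s)).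
Proof.
elim: s => //= x s IH /andP[xNs us] Hf Hinj; rewrite cat_uniq Hf ?mem_head //=.
apply/andP; split; last first.
  apply: IH => // [y Hy|y z b Hy Hz]; first by rewrite Hf // inE Hy orbT.
  by apply: Hinj; rewrite inE ?Hy ?Hz orbT.
apply/hasPn => b /flattenP[_ /mapP[y Hy ->] Hb]; apply/negP => /= Hbx.
by move: xNs; rewrite (Hinj x y b) ?Hy ?mem_head // inE Hy orbT.
Qed.

Lemma uniq_seeds l : level n l -> uniq (seeds l).
Proof.
move=> Hl; apply/(uniqP 0) => a b Ha Hb E.
have [p [Ep _ lab_p]] := seed_pixel Hl Ha; have [q [Eq _ lab_q]] := seed_pixel Hl Hb.
by case: (index_of_inj (etrans (esym Ep) (etrans E Eq))) lab_p => _ ->; rewrite lab_q => -[].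
Qed.

Lemma uniq_all_seeds : uniq (all_seeds sds).
Proof.
apply: uniq_flatten_map; first exact: iota_uniq.
  move=> l; rewrite mem_iota size_sds => Hl; rewrite /level_seeds.
  case: odd => //; rewrite map_inj_uniq; last by move=> ? ? [].
  by apply: uniq_seeds; rewrite /level; lia.
move=> l l' [l0 i] _ _; rewrite /level_seeds; case: odd; case: odd => //.
by case/mapP=> ? _ [<- _] /mapP[? _ [<- _]].
Qed.

Lemma mem_seed_edges li e : (e \in seed_edges S (n + n - 1) lab li) =
  [&& e.1.1 == li.1, e.1.2 == lab li.2 &
   [&& 1 < li.1, e.2.1 == li.1.-1 & e.2.2 == lab (li.2 - S)] ||
   [&& li.1 < n + n - 1, e.2.1 == li.1.+1 & e.2.2 == lab (li.2 + S)]].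
Proof.
case: li e => [l i] [[l1 a] [l2 b]] /=; rewrite mem_cat !subn_gt0 addn1 subn1.
by case: ifP => _; case: ifP => _; rewrite ?inE /= ?orbF ?andbF //
  ?xpair_eqE /= -?andbA -?andb_orr //; do ![case: (_ == _) => //=].
Qed.

Lemma index_of_succ l p : index_of l p + S = index_of l.+1 p.
Proof. by rewrite /index_of /pixel_index (mulSn l); lia. Qed.

Lemma index_of_pred l p : 1 < l -> index_of l p - S = index_of l.-1 p.
Proof. by case: l => // l _; rewrite -index_of_succ addnK. Qed.

(** The label of a pixel at level [l'] depends only on its component at level [l],
    as the image of level [l] is contained in that of [l']; so the seed of the
    component can stand for any of its pixels. *)
Lemma mem_es l a l' b : ((l, a), (l', b)) \in es <->
  [/\ level n l, level n l', arrow l l' &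
   exists p, [/\ level_image V l p, plab l p = a & plab l' p = b]].
Proof.
split=> [/flatten_mapP[[l0 i]]|[Hl Hl' Harrow [p [Hp Ea Eb]]]].
  rewrite mem_all_seeds mem_seed_edges /= => /and3P[Hl Hodd].
  move=> /(nthP 0)[a' Ha' Ei] /and3P[/eqP El /eqP Ea Hb]; subst l0.
  have [p [Ep Hp _]] := seed_pixel Hl Ha'; rewrite Ep in Ei.
  have Hlevels := Hl; rewrite /level in Hlevels.
  case/orP: Hb => /and3P[lt_l /eqP -> /eqP ->].
    split; rewrite ?/arrow ?/level ?Hodd /=; [by []|by lia|by lia|].
    by exists p; rewrite /plab -index_of_pred // Ei Ea.
  split; rewrite ?/arrow ?/level ?Hodd /= ?eqxx //; first by lia.
  by exists p; rewrite /plab -index_of_succ Ei Ea.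
have [q [Eq Hq lab_q Cpq]] := plab_seed Hl Hp.
apply/flatten_mapP; exists (l, index_of l q).
  rewrite mem_all_seeds Hl -Eq mem_nth; last by case/andP: (plab_range Hl Hp) => gt0 le; rewrite prednK.
  by case/andP: Harrow => ->.
have lab_q' : plab l' p = plab l' q.
  apply/(plab_connect Hl'); try exact: level_image_sub Harrow _.
  by apply: pixel_connect_sub Cpq => r; apply: level_image_sub.
rewrite mem_seed_edges /= eqxx -/(plab l q) lab_q Ea eqxx -Eb lab_q' /plab /=.
move: Hl Hl'; rewrite /level => Hl Hl'.
case/andP: Harrow => _ /orP[] /eqP El; apply/orP.
  right; rewrite El index_of_succ !eqxx !andbT; lia.
left; rewrite index_of_pred El /= ?eqxx ?andbT; lia.
Qed.

Lemma uniq_es : uniq es.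
Proof.
apply: uniq_flatten_map uniq_all_seeds _ _ => [[l i] _|[l i] [l' i'] [[l1 a] [l2 b]]].
  rewrite /seed_edges; case: ifP => lt_l; case: ifP => // _ /=.
  by rewrite inE !xpair_eqE /= andbT; apply/negP => /andP[_ /andP[/eqP]]; lia.
rewrite !mem_all_seeds !mem_seed_edges /= => /and3P[Hl _ Hi] /and3P[Hl' _ Hi'].
case/and3P=> /eqP El /eqP Ea _ /and3P[/eqP El' /eqP Ea' _].
have El2 : l' = l := etrans (esym El') El.
have : lab i' = lab i := etrans (esym Ea') Ea.
move: Hi Hi' Hl'; rewrite El2 => /(nthP 0)[c lt_c <-] /(nthP 0)[c' lt_c' <-] _.
have [p [Ep _ lab_p]] := seed_pixel Hl lt_c.
have [q [Eq _ lab_q]] := seed_pixel Hl lt_c'.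
rewrite Ep Eq -!/(plab _ _) lab_p lab_q => -[Ec].
by rewrite -Ep -Eq Ec.
Qed.

Theorem labelling_merge_graph :
  pixel_merge_graph V ((n + n - 1) :: m ++ flatten [seq edge_numbers e | e <- es]).
Proof.
exists m, plab, es; split.
- split; first by rewrite size_map size_sds addnn subn1.
  by rewrite /encode_graph size_map size_sds.
- by move=> l p Hl Hp; rewrite nth_m //; apply: plab_range.
- move=> l a Hl; rewrite nth_m // => /andP[a_gt0 le_a].
  have [|p [_ Hp lab_p]] := @seed_pixel l a.-1 Hl; first by lia.
  by exists p => //; rewrite lab_p; lia.
- exact: plab_connect.
- by split; [exact: uniq_es|exact: mem_es].
Qed.

Lemma size_all_seeds : size (all_seeds sds) <= (n + n - 1) * S.
Proof.
have bound (s : seq nat) : {subset s <= iota 1 (size sds)} ->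
    size (flatten [seq level_seeds l (seeds l) | l <- s]) <= size s * S.
  elim: s => //= l s IH Hs; rewrite size_cat mulSn leq_add ?IH //; last first.
    by move=> l' Hl'; apply: Hs; rewrite inE Hl' orbT.
  have /Hs : l \in l :: s by rewrite mem_head.
  rewrite mem_iota /level_seeds => Hl; case: odd => //; rewrite size_map.
  by apply: (Hlab _).1; lia.
rewrite -size_sds -(size_iota 1 (size sds)); exact: bound.
Qed.

End Output.

End Drawn.

End Video.

(** [S] is at most [4 * w * h] and [L] at most [2 * n]; the lower-order terms are
    at most [n * w * h], as the three dimensions are positive. The factor is a
    product because literals of type [nat] are unary. *)
Lemma total_time n w h : 0 < n -> 0 < w -> 0 < h ->
  forall S L, S = h.+1 * (w + 1) -> L = n + n - 1 ->
  read_time n w h + (label_time L S + edges_time (L * S)) <= 130 * 100 * (n * w * h).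
Proof.
move=> n_gt0 w_gt0 h_gt0 S L ES EL; pose N := n * w * h.
have S_gt0 : 0 < S by rewrite ES muln_gt0 addn1.
have le_S : S <= 4 * (w * h) by nia.
have le_LS : L * S <= 8 * N.
  apply: leq_trans (leq_mul (_ : L <= 2 * n) le_S) _; first by lia.
  by rewrite /N; lia.
have le_L : L <= 8 * N by apply: leq_trans le_LS; rewrite leq_pmulr.
have N_gt0 : 0 < N by rewrite !muln_gt0 n_gt0 w_gt0.
have le_nh : n * h <= N by rewrite /N mulnAC leq_pmulr.
have le_n : n <= N by apply: leq_trans le_nh; rewrite leq_pmulr.
have le_h : h <= N by apply: leq_trans le_nh; rewrite leq_pmull.
(* The coefficients below are the evaluated costs of the loop-free parts. *)
have read_le : read_time n w h <= 85 * N + 16 * (n * h) + 23 * n + 10 * h + 69.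
  rewrite /read_time; have [-> -> -> -> [-> ->]] : [/\ cost read_header = 10,
    cost (Assign VS (Plus VS VW)) = 7, cost set_offsets = 33, cost read_pixel = 82
    & cost (Assign Vpos (Plus Vpos 1)) = 6 /\
      cost (Assign Vpos (Plus Vpos (Plus VS VW))) = 10] by [].
  by rewrite /N; lia.
have label_le : label_time L S <= 1198 * (L * S) + 48 * L + 29.
  rewrite /label_time /level_time; have [-> -> -> ->] : [/\ cost start_levels = 22,
    cost enter_level = 20, cost flood_step = 596 & cost leave_level = 15] by [].
  by lia.
have edges_le : edges_time (L * S) <= 7 + 108 * (L * S).
  by rewrite /edges_time; have -> : cost print_seed_edges = 105 by []; lia.
by rewrite -/N; lia.
Qed.

Theorem program_correct n w h (V : video n w h) :
  0 < n -> 0 < w -> 0 < h ->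
  exists t out,
    [/\ computes_in (compile merge_graph_program 0 0) (encode_video V) t out,
        t <= 130 * 100 * (n * w * h) & pixel_merge_graph V out].
Proof.
move=> n_gt0 w_gt0 h_gt0.
pose W := w + 1; pose S := h.+1 * W; pose L := n + n - 1.
pose k := conn V.
pose d1 := if 4 < conn_code k then w else 1.
pose d2 := if 4 < conn_code k then W + 1 else W.
pose hit img := drawn w h (pixel_value V) (video_pixels w h n) img.
pose Post s := pixel_merge_graph V (printed s).
suff H : triple (eq (blank_state (encode_video V))) merge_graph_program
    (read_time n w h + (label_time L S + edges_time (L * S))) Post.
  have [t [s [Hc le_t Hs]]] := triple_computes H.
  exists t, (printed s); split=> //; apply: leq_trans le_t _.
  exact: total_time (erefl S) (erefl L).
rewrite encode_videoE.
apply: triple_seq; first exact: read_frames_triple.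
move=> s [img Hd Hs].
pose Mid s := exists2 sds, size sds = L & levels_at n W S d1 d2 img (linked V) sds s.
suff H : triple (levels_start n W S d1 d2 img) (Seq label_levels print_edges) (label_time L S + edges_time (L * S)) Post.
  exact: H.
apply: (triple_seq (Mid := Mid)).
  apply: label_levels_triple.
  - exact: linked_refl Hd.
  - exact: linked_trans.
  - exact: linked_adj Hd.
  - exact: offsets_le.
move=> {Hs}s [sds size_sds [Hc _ Hp Hs [Hlab _]]].
have := @print_edges_triple S L (cells s Label) (all_seeds sds) (L :: map size sds) s.
case; first by case: Hc => *; split.
move=> t [s' [E le_t Hs']]; exists t, s'; split=> //.
  apply: leq_trans le_t _; rewrite leq_add2l leq_mul2r.
  by rewrite (size_all_seeds size_sds Hlab) orbT.
by rewrite /Post Hs'; apply: labelling_merge_graph Hd _ _ size_sds Hlab.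
Qed.

(** * Path components of a finite union of boxes *)

Section PlanePaths.

Import Order.TTheory GRing.Theory Num.Theory numFieldNormedType.Exports.
Local Open Scope classical_set_scope.
Local Open Scope ring_scope.

Variable R : realType.

Definition clamp (t : R) : R := Num.max 0 (Num.min 1 t).

Lemma clamp_continuous : continuous clamp.
Proof.
move=> t; apply: (@continuous_max R R (fun=> 0) (fun t => Num.min 1 t)).
  exact: cst_continuous.
apply: (@continuous_min R R (fun=> 1) id); first exact: cst_continuous.
exact: cvg_id.
Qed.

Lemma clamp_range t : 0 <= clamp t <= 1.
Proof.
by rewrite /clamp /Num.max /Num.min; case: (ltP 1 t) => *; case: ltP => *; apply/andP; split; lra.
Qed.

Lemma clamp_le0 t : t <= 0 -> clamp t = 0.
Proof. by move=> *; rewrite /clamp /Num.max /Num.min; case: (ltP 1 t) => *; case: ltP => *; lra. Qed.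

Lemma clamp_ge1 t : 1 <= t -> clamp t = 1.
Proof. by move=> *; rewrite /clamp /Num.max /Num.min; case: (ltP 1 t) => *; case: ltP => *; lra. Qed.

Section Paths.

Variable T : topologicalType.

(** Paths extended by constants to the whole line: they need no restriction of
    continuity to a segment, and their concatenation has a closed formula. *)
Definition path_in (A : set T) (x y : T) := exists g : R -> T,
  [/\ continuous g, forall t, t <= 0 -> g t = x, forall t, 1 <= t -> g t = y
    & forall t, A (g t)].

Lemma joined_pathP (A : set T) x y : joined_in R A x y <-> path_in A x y.
Proof.
split=> [[g [g_cont g0 g1 gA]]|[g [g_cont g0 g1 gA]]].
  exists (g \o clamp); split=> [t|t /clamp_le0|t /clamp_ge1|t] /=.
  - apply: (@cvg_comp _ _ _ clamp g (nbhs t) (within `[0, 1] (nbhs (clamp t)))).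
      move=> U HU; change (nbhs t (clamp @^-1` U)).
      apply: filterS (clamp_continuous HU : nbhs t _) => s /=.
      by apply; rewrite in_itv /= clamp_range.
    apply: (subspace_continuousP _ _).1 => //; rewrite /= in_itv /= clamp_range //.
  - by move=> ->.
  - by move=> ->.
  - exact/gA/clamp_range.
exists g; split; [exact: continuous_subspaceT|exact: g0|exact: g1|].
by move=> t _; apply: gA.
Qed.

Lemma path_in_refl A x : A x -> path_in A x x.
Proof. by move=> Ax; exists (fun=> x); split=> // t; apply: cvg_cst. Qed.

Lemma path_in_sym A x y : path_in A x y -> path_in A y x.
Proof.
case=> g [g_cont g0 g1 gA]; exists (fun t => g (1 - t)); split=> [t|t t_le|t t_ge|t].
- apply: (@continuous_comp _ _ _ (fun t : R => 1 - t) g); last exact: g_cont.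
  by apply: continuousB; [apply: cst_continuous|apply: cvg_id].
- by apply: g1; lra.
- by apply: g0; lra.
- exact: gA.
Qed.

Lemma path_in_sub A B x y : A `<=` B -> path_in A x y -> path_in B x y.
Proof.
by move=> AB [g [g_cont g0 g1 gA]]; exists g; split=> // t; apply: AB.
Qed.

(** A path in a set covered by two disjoint closed sets stays in one of them, by
    connectedness of the segment. *)
Lemma path_in_stays A C D x y :
  closed C -> closed D -> A `<=` C `|` D -> C `&` D = set0 -> C x ->
  path_in A x y -> C y.
Proof.
move=> C_closed D_closed A_cover CD0 Cx [g [g_cont g0 g1 gA]].
have gC_closed : closed (g @^-1` C) by apply: closed_comp => // t _; apply: g_cont.
have gD_closed : closed (g @^-1` D) by apply: closed_comp => // t _; apply: g_cont.
have gC t : (g @^-1` C) t <-> ~ (g @^-1` D) t.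
  split=> /= [gCt gDt|gDt]; last by case: (A_cover _ (gA t)).
  by have : (C `&` D) (g t) by []; rewrite CD0.
have E : (`[0, 1]%classic : set R) `&` g @^-1` C = `[0, 1]%classic.
  apply: (@segment_connected R 0 1).
  - by exists 0; rewrite /= in_itv /= lexx ler01 g0.
  - exists (~` (g @^-1` D)); first exact: closed_openC.
    by congr (_ `&` _); apply/seteqP; split=> t /gC.
  - by exists (g @^-1` C).
rewrite -(g1 1) //; have : (`[0, 1]%classic : set R) 1 by rewrite /= in_itv /= ler01 lexx.
by rewrite -E => -[].
Qed.

End Paths.

Notation plane := (R * R)%type.

(** On the first half the second path rests at [y], on the second half the first
    one does; hence their sum minus [y] is the concatenation, and its continuity
    needs no gluing. *)
Lemma path_in_trans (A : set plane) x y z :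
  path_in A x y -> path_in A y z -> path_in A x z.
Proof.
case=> g [g_cont g0 g1 gA] [f [f_cont f0 f1 fA]].
exists (fun t => g (2 * t) + f (2 * t - 1) - y); split=> [t|t t_le|t t_ge|t].
- have c2 : continuous (fun t : R => 2 * t).
    exact: mulrl_continuous.
  apply: cvgB; last exact: cvg_cst.
  apply: cvgD.
    by apply: (@continuous_comp _ _ _ _ g); [apply: c2|apply: g_cont].
  apply: (@continuous_comp _ _ _ (fun t : R => 2 * t - 1) f); last exact: f_cont.
  by apply: continuousB; [apply: c2|apply: cst_continuous].
- by rewrite g0 ?f0 ?addrK //; lra.
- by rewrite g1 ?f1; [rewrite addrAC subrr add0r|lra|lra].
- case: (leP t 2^-1) => Ht; first by rewrite [f _]f0 ?addrK //; lra.
  by rewrite [g _]g1 1?addrAC ?subrr ?add0r //; lra.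
Qed.

Definition box (a b c d : R) : set plane := `[a, b] `*` `[c, d].

Lemma box_closed a b c d : closed (box a b c d).
Proof.
have -> : box a b c d = fst @^-1` `[a, b] `&` snd @^-1` `[c, d].
  by apply/seteqP; split=> z.
apply: closedI; apply: closed_comp.
- by move=> z _; apply: cvg_fst.
- exact: interval_closed.
- by move=> z _; apply: cvg_snd.
- exact: interval_closed.
Qed.

Lemma box_path a b c d x y : box a b c d x -> box a b c d y ->
  path_in (box a b c d) x y.
Proof.
rewrite /box /= !in_itv /= => -[/andP[x1 x2] /andP[x3 x4]] [/andP[y1 y2] /andP[y3 y4]].
exists (fun t => x + clamp t *: (y - x)); split=> [t|t /clamp_le0 ->|t /clamp_ge1 ->|t].
- apply: cvgD; first exact: cvg_cst.
  apply: cvgZ; first exact: clamp_continuous.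
  exact: cvg_cst.
- by rewrite scale0r addr0.
- by rewrite scale1r addrC subrK.
- rewrite /= !in_itv /=; have /andP[s0 s1] := clamp_range t.
  move: (clamp t) s0 s1 => s s0 s1; rewrite /GRing.scale /=.
  by split; apply/andP; split; nra.
Qed.

Section Boxes.

Variables (I : finType) (D : set I) (B : I -> set plane) (C : set I).

(** The boxes in [C] and those outside of it have disjoint closed unions. *)
Lemma path_in_boxes x y t t' :
  (forall t, closed (B t)) ->
  (forall t t' z, D t -> D t' -> B t z -> B t' z -> C t -> C t') ->
  path_in (\bigcup_(t in D) B t) x y -> D t -> B t x -> C t ->
  D t' -> B t' y -> C t'.
Proof.
move=> B_closed C_inter Hxy Dt Btx Ct Dt' Bt'y.
have union_closed (E : set I) : closed (\bigcup_(t in E) B t).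
  by apply: closed_bigcup => //; apply: finite_finset.
have : (\bigcup_(t in D `&` C) B t) y.
  apply: (path_in_stays (union_closed (D `&` C)) (union_closed (D `&` ~` C))) Hxy.
  - move=> z [u Du Bu]; have [Cu|Cu] := pselect (C u); [left|right]; exists u => //.
  - apply/seteqP; split=> // z [[u [Du Cu] Bu] [u' [Du' Cu'] Bu']].
    exact/Cu'/(C_inter u u' z).
  - by exists t.
by case=> u [Du Cu] Bu; apply: (C_inter u t' y).
Qed.

End Boxes.

End PlanePaths.

(** * Foreground components are components of the pixel graph *)

Section Foreground.

Import Order.TTheory GRing.Theory Num.Theory numFieldNormedType.Exports.
Local Open Scope classical_set_scope.
Local Open Scope ring_scope.

Variable R : realType.

Let plane := (R * R)%type.

(** A foreground is seen as a union of closed boxes [B t], each containing the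
    centre of a representative pixel [rep t]. Both connectivities fit: boxes that
    meet have connected representatives, and centres of adjacent pixels are joined
    through two boxes that meet. *)
Section BoxUnion.

Variables (P : finType) (adj : rel P) (fg : pred P) (center : P -> plane).
Variables (I : finType) (D : set I) (B : I -> set plane) (rep : I -> P).

Hypothesis adj_fg : forall p q, adj p q -> fg q.
Hypothesis B_box : forall t, exists a b c d, B t = box a b c d.
Hypothesis rep_fg : forall t, D t -> fg (rep t) /\ B t (center (rep t)).
Hypothesis fg_rep : forall p, fg p -> exists2 t, D t & rep t = p.
Hypothesis B_meet : forall t t' z, D t -> D t' -> B t z -> B t' z ->
  connect adj (rep t) (rep t').
Hypothesis adj_meet : forall p q, adj p q -> exists t t' z,
  [/\ D t /\ D t', B t (center p), B t z, B t' z & B t' (center q)].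

Let F := \bigcup_(t in D) B t.

Let path_box t x y : D t -> B t x -> B t y -> path_in R F x y.
Proof.
move=> Dt; have [a [b [c [d EB]]]] := B_box t => Bx By.
apply: (@path_in_sub R _ (B t)); first by move=> z Bz; exists t.
by rewrite EB in Bx By *; apply: box_path.
Qed.

Lemma union_center p : fg p -> F (center p).
Proof. by move=> /fg_rep[t Dt <-]; exists t => //; have [] := rep_fg Dt. Qed.

Lemma union_point x : F x -> exists2 p, fg p & joined_in R F (center p) x.
Proof.
case=> t Dt Btx; have [fg_t Btc] := rep_fg Dt; exists (rep t) => //.
by apply/joined_pathP; apply: path_box Btx.
Qed.

Lemma union_joined p q : fg p -> fg q ->
  joined_in R F (center p) (center q) <-> connect adj p q.
Proof.
move=> fg_p fg_q; split=> [/joined_pathP Hpq|/connectP[s]].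
  have [t Dt Et] := fg_rep fg_p; have [t' Dt' Et'] := fg_rep fg_q.
  have [_] := rep_fg Dt; have [_] := rep_fg Dt'; rewrite Et Et' => Bq Bp.
  rewrite -Et'; apply: (@path_in_boxes R I D B
    [set u | connect adj p (rep u)] _ _ _ _ _ _ Hpq Dt Bp _ Dt' Bq).
  - by move=> u; have [a [b [c [d ->]]]] := B_box u; apply: box_closed.
  - move=> u u' z Du Du' Bu Bu' /= Hu.
    exact: connect_trans Hu (B_meet Du Du' Bu Bu').
  - by rewrite /= Et; apply: connect0.
move=> Hs ->; apply/joined_pathP; elim: s p fg_p Hs => [|r s IH] p fg_p /=.
  by move=> _; apply/path_in_refl/union_center.
case/andP=> Hpr Hs; have [t [t' [z [[Dt Dt'] Bp Bz Bz' Br]]]] := adj_meet Hpr.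
apply: path_in_trans (path_box Dt Bp Bz) _.
apply: path_in_trans (path_box Dt' Bz' Br) _.
exact: IH (adj_fg Hpr) Hs.
Qed.

End BoxUnion.

Section Pixels.

Variables (w h : nat) (k : connectivity) (J : binary_image w h).
Local Notation pixel := ('I_w * 'I_h)%type.
Local Notation square := (@pixel_square R w h).
Local Notation kcell := (@cell R w h).
Implicit Types p q : pixel.

Definition pixel_center p : plane := (xcoord R p, ycoord R p).

Let natrS2 (m : nat) : m.+2%:R = m.+1%:R + 1 :> R.
Proof. by rewrite -natr1. Qed.

Let half_gt0 : 0 < 2^-1 :> R. Proof. by rewrite invr_gt0. Qed.

Lemma near8_coord (a b : nat) (z : R) :
  a.+1%:R - 2^-1 <= z -> z <= b.+1%:R + 2^-1 -> (a <= b.+1)%N.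
Proof.
move=> Ha Hb; rewrite -ltnS -(ler_nat R) natrS2; lra.
Qed.

Lemma pixel_square_meet p q z :
  square p z -> square q z -> touching Conn8 p.1 p.2 q.1 q.2.
Proof.
rewrite /pixel_square /xcoord /ycoord /= !in_itv /=.
move=> [/andP[p1 p2] /andP[p3 p4]] [/andP[q1 q2] /andP[q3 q4]].
by rewrite (near8_coord p1 q2) (near8_coord q1 p2) (near8_coord p3 q4) (near8_coord q3 p4).
Qed.

Lemma pixel_square_near p q : touching Conn8 p.1 p.2 q.1 q.2 ->
  exists z, square p z /\ square q z.
Proof.
have coord (a b : nat) : (a <= b.+1)%N -> a.+1%:R <= b.+1%:R + 1 :> R.
  by move=> le_ab; rewrite -natrS2 ler_nat ltnS.
case/and4P=> /coord x1 /coord x2 /coord y1 /coord y2.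
(* The midpoint of the two centres. *)
exists ((xcoord R p + xcoord R q) / 2, (ycoord R p + ycoord R q) / 2).
rewrite /pixel_square /xcoord /ycoord /= !in_itv /=.
by do 2!split; apply/andP; split; lra.
Qed.

Lemma pixel_square_center p : square p (pixel_center p).
Proof.
rewrite /pixel_square /= !in_itv /=; have := half_gt0.
by split; apply/andP; split; lra.
Qed.

Definition lit_cell (c : pixel * pixel) : Prop :=
  is_cell c.1 c.2 /\ forall p, cell_vertex c.1 c.2 p -> J p.

Lemma cell_center lo hi p : cell_vertex lo hi p -> kcell lo hi (pixel_center p).
Proof.
case/andP=> /andP[? ?] /andP[? ?]; rewrite /cell /= !in_itv /=.
by rewrite /xcoord /ycoord !ler_nat !ltnS; split; apply/andP.
Qed.

(** A corner is reached from the lower left one by moving along the first axis,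
    then along the second. *)
Lemma cell_connect lo hi p : lit_cell (lo, hi) -> cell_vertex lo hi p ->
  connect (pixel_graph Conn4 J) lo p.
Proof.
move=> [/= Hcell Hlit] Hp; pose r : pixel := (p.1, lo.2).
move: (Hcell) (Hp) => /andP[/andP[c1 c2] /andP[c3 c4]] /andP[/andP[p1 p2] /andP[p3 p4]].
have Jlo : J lo by apply: Hlit; rewrite /cell_vertex !leqnn c1 c3.
have Jr : J r by apply: Hlit; rewrite /cell_vertex /= p1 p2 leqnn c3.
apply: (@connect_trans _ _ r); apply: connect1.
  rewrite /pixel_graph Jlo Jr /= eqxx; apply/orP; right; rewrite /=; lia.
rewrite /pixel_graph Jr (Hlit _ Hp) /= eqxx; apply/orP; left; rewrite /=; lia.
Qed.

(** Two cells of the complex that meet share a corner: the coordinatewise maximum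
    of their lower left corners. *)
Lemma cell_meet lo hi lo' hi' z : lit_cell (lo, hi) -> lit_cell (lo', hi') ->
  kcell lo hi z -> kcell lo' hi' z -> connect (pixel_graph Conn4 J) lo lo'.
Proof.
move=> H H'; rewrite /cell /xcoord /ycoord /= !in_itv /=.
move=> [/andP[p1 p2] /andP[p3 p4]] [/andP[q1 q2] /andP[q3 q4]].
have coord (a b : nat) (u : R) : a.+1%:R <= u -> u <= b.+1%:R -> (a <= b)%N.
  by move=> Ha Hb; rewrite -ltnS -(ler_nat R); apply: le_trans Ha Hb.
have x1 := coord _ _ _ p1 q2; have x2 := coord _ _ _ q1 p2.
have y1 := coord _ _ _ p3 q4; have y2 := coord _ _ _ q3 p4.
pose v : pixel := (if (lo.1 <= lo'.1)%N then lo'.1 else lo.1,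
                   if (lo.2 <= lo'.2)%N then lo'.2 else lo.2).
move: (H.1) (H'.1) => /= /andP[/andP[c1 c2] /andP[c3 c4]].
move=> /andP[/andP[c1' c2'] /andP[c3' c4']].
clear p1 p2 p3 p4 q1 q2 q3 q4 coord.
have vH : cell_vertex lo hi v.
  by rewrite /cell_vertex /v /=; case: (leqP lo.1 lo'.1) => ?; case: (leqP lo.2 lo'.2) => ?; apply/andP; split; lia.
have vH' : cell_vertex lo' hi' v.
  by rewrite /cell_vertex /v /=; case: (leqP lo.1 lo'.1) => ?; case: (leqP lo.2 lo'.2) => ?; apply/andP; split; lia.
apply: connect_trans (cell_connect H vH) _.
by rewrite pixel_connect_sym; exact: cell_connect H' vH'.
Qed.

(** Neighbours for 4-connectivity agree in one coordinate, so one of them is the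
    lower left corner of a cell with no corner besides these two. *)
Lemma cell_near p q : pixel_graph Conn4 J p q -> exists c,
  [/\ lit_cell c, kcell c.1 c.2 (pixel_center p) & kcell c.1 c.2 (pixel_center q)].
Proof.
case/and3P=> Jp Jq Hnear.
have [[lo hi] [Hcell Hv Hp Hq]] : exists c : pixel * pixel,
    [/\ is_cell c.1 c.2, forall r, cell_vertex c.1 c.2 r -> r = p \/ r = q,
        cell_vertex c.1 c.2 p & cell_vertex c.1 c.2 q].
  have pair_eq (r s : pixel) : val r.1 = val s.1 -> val r.2 = val s.2 -> r = s.
    by case: r s => [? ?] [? ?] /= /val_inj -> /val_inj ->.
  have Hle : (p.1 <= q.1 /\ p.2 <= q.2)%N \/ (q.1 <= p.1 /\ q.2 <= p.2)%N.
    by move: Hnear => /=; lia.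
  case: Hle => Hle; [exists (p, q)|exists (q, p)];
    rewrite /is_cell /cell_vertex /=; split; try (by move: Hnear => /=; lia).
    move=> r Hr; have [|] : (r.1 = p.1 :> nat /\ r.2 = p.2 :> nat) \/
      (r.1 = q.1 :> nat /\ r.2 = q.2 :> nat) by move: Hnear Hr => /=; lia.
      by case=> *; left; apply: pair_eq.
    by case=> *; right; apply: pair_eq.
  move=> r Hr; have [|] : (r.1 = p.1 :> nat /\ r.2 = p.2 :> nat) \/
    (r.1 = q.1 :> nat /\ r.2 = q.2 :> nat) by move: Hnear Hr => /=; lia.
    by case=> *; left; apply: pair_eq.
  by case=> *; right; apply: pair_eq.
exists (lo, hi); split; [|exact: cell_center|exact: cell_center].
split=> /=; first exact: Hcell.
by move=> r /Hv[->|->].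
Qed.

Lemma lit_pixel p : J p -> lit_cell (p, p).
Proof.
move=> Jp; rewrite /lit_cell /is_cell /cell_vertex /= !leqnn !leqnSn; split=> // r.
rewrite -!eqn_leq => /andP[/eqP/val_inj E1 /eqP/val_inj E2].
by case: r E1 E2 => r1 r2 /= <- <-; case: p Jp.
Qed.

Let graph_fg p q : pixel_graph k J p q -> J q.
Proof. by case/and3P. Qed.

Lemma foreground_pixels :
  [/\ forall p, J p -> foreground R k J (pixel_center p),
      forall x, foreground R k J x ->
        exists2 p, J p & joined_in R (foreground R k J) (pixel_center p) x
    & forall p q, J p -> J q ->
        joined_in R (foreground R k J) (pixel_center p) (pixel_center q) <->
        pixel_connect k J p q].
Proof.
rewrite /pixel_connect; move: graph_fg; case: k => adj_fg; rewrite /foreground.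
- have B_box (c : pixel * pixel) : exists x1 x2 y1 y2, kcell c.1 c.2 = box x1 x2 y1 y2.
    by do 4!eexists.
  have rep_fg (c : pixel * pixel) : lit_cell c -> J c.1 /\ kcell c.1 c.2 (pixel_center c.1).
    case: c => lo hi [/= Hcell Hlit]; have Hlo : cell_vertex lo hi lo.
      by case/andP: Hcell => /andP[c1 c2] /andP[c3 c4]; rewrite /cell_vertex !leqnn c1 c3.
    by split; [apply: Hlit|apply: cell_center].
  have fg_rep p : J p -> exists2 c, lit_cell c & c.1 = p.
    by move=> /lit_pixel Hp; exists (p, p).
  have B_meet (c c' : pixel * pixel) z : lit_cell c -> lit_cell c' ->
      kcell c.1 c.2 z -> kcell c'.1 c'.2 z ->
      connect (pixel_graph Conn4 J) c.1 c'.1.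
    by case: c c' => [lo hi] [lo' hi']; apply: cell_meet.
  have adj_meet p q : pixel_graph Conn4 J p q -> exists c c' z,
      [/\ lit_cell c /\ lit_cell c', kcell c.1 c.2 (pixel_center p), kcell c.1 c.2 z,
          kcell c'.1 c'.2 z & kcell c'.1 c'.2 (pixel_center q)].
    by move=> /cell_near[c [Hc Hp Hq]]; exists c, c, (pixel_center p).
  split.
  + exact: union_center rep_fg fg_rep.
  + exact: union_point B_box rep_fg.
  + exact: union_joined adj_fg B_box rep_fg fg_rep B_meet adj_meet.
- have B_box (p : pixel) : exists x1 x2 y1 y2, square p = box x1 x2 y1 y2.
    by do 4!eexists.
  have rep_fg p : J p -> J p /\ square p (pixel_center p).
    by move=> Jp; split=> //; apply: pixel_square_center.
  have fg_rep p : J p -> exists2 q, J q & q = p by exists p.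
  have B_meet p q z : J p -> J q -> square p z -> square q z ->
      connect (pixel_graph Conn8 J) p q.
    move=> Jp Jq Hp Hq; apply: connect1; apply/and3P; split=> //.
    exact: pixel_square_meet Hp Hq.
  have adj_meet p q : pixel_graph Conn8 J p q -> exists r s z,
      [/\ J r /\ J s, square r (pixel_center p), square r z,
          square s z & square s (pixel_center q)].
    case/and3P=> Jp Jq /pixel_square_near[z [Hp Hq]].
    by exists p, q, z; split=> //; apply: pixel_square_center.
  split.
  + exact: (union_center (D := [set p | J p])) rep_fg fg_rep.
  + exact: (union_point (D := [set p | J p])) B_box rep_fg.
  + exact: (union_joined (D := [set p | J p])) adj_fg B_box rep_fg fg_rep B_meet adj_meet.
Qed.

End Pixels.

Lemma foreground_sub w h k (I J : binary_image w h) :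
  (forall p, I p -> J p) -> foreground R k I `<=` foreground R k J.
Proof.
move=> IJ x; case: k => [[c [Hc Hlit] Hx]|[p Ip Hx]].
  by exists c => //; split=> // p /Hlit /IJ.
by exists p => //; apply: IJ.
Qed.

End Foreground.

(** * From pixels to path components *)

Section Components.

Import numFieldNormedType.Exports.
Local Open Scope classical_set_scope.

Variables (R : realType) (n w h : nat) (V : video n w h).

Let F l := union_space R V l.

Definition component l (p : 'I_w * 'I_h) : set (R * R) :=
  joined_in R (F l) (pixel_center R p).

Lemma component_eq l p q : level_image V l p -> level_image V l q ->
  pixel_connect (conn V) (level_image V l) p q -> component l p = component l q.
Proof.
move=> Hp Hq Hpq; have [_ _ joinP] := foreground_pixels R (conn V) (level_image V l).
have /joined_pathP Jpq := (joinP _ _ Hp Hq).2 Hpq.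
apply/seteqP; split=> x /joined_pathP Hx; apply/joined_pathP.
  exact: path_in_trans (path_in_sym Jpq) Hx.
exact: path_in_trans Jpq Hx.
Qed.

Lemma component_center l p q : level_image V l p -> level_image V l q ->
  component l p (pixel_center R q) <-> pixel_connect (conn V) (level_image V l) p q.
Proof.
by move=> Hp Hq; have [_ _] := foreground_pixels R (conn V) (level_image V l); apply.
Qed.

Lemma component_self l p : level_image V l p -> component l p (pixel_center R p).
Proof. by move=> Hp; apply/component_center => //; apply: connect0. Qed.

Lemma component_vertex l p : level_image V l p ->
  path_components R (F l) (component l p).
Proof.
move=> Hp; exists (pixel_center R p) => //.
by have [H _ _] := foreground_pixels R (conn V) (level_image V l); apply: H.
Qed.

Lemma vertex_component l C : path_components R (F l) C ->
  exists2 p, level_image V l p & C = component l p.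
Proof.
have [_ H _] := foreground_pixels R (conn V) (level_image V l).
case=> x /H[p Hp /joined_pathP Hpx] <-; exists p => //.
apply/seteqP; split=> y /joined_pathP Hy; apply/joined_pathP.
  exact: path_in_trans Hpx Hy.
exact: path_in_trans (path_in_sym Hpx) Hy.
Qed.

Lemma component_sub l l' p : level_image V l p -> arrow l l' ->
  component l p `<=` component l' p.
Proof.
move=> Hp Harrow x /joined_pathP Hx; apply/joined_pathP; apply: path_in_sub Hx.
by apply: foreground_sub => q; apply: level_image_sub.
Qed.

(** Components are determined by the pixels whose centres they contain. A component
    [C] at an odd level is contained in [C'] exactly when a pixel of [C] lies in
    [C']. *)
Theorem pixel_merge_graph_outputs out :
  pixel_merge_graph V out -> outputs_merge_graph R V out.
Proof.
case=> m [plab [es [[size_m ->] range onto same [uniq_es mem_es]]]].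
pose lab l (C : set (R * R)) :=
  if pselect (exists2 p, level_image V l p & C (pixel_center R p)) is left H
  then plab l (s2val (cid2 H)) else 0.
have labE l p : level n l -> level_image V l p -> lab l (component l p) = plab l p.
  move=> Hl Hp; rewrite /lab; case: pselect => [H|[]]; last first.
    by exists p => //; apply: component_self.
  case: (cid2 H) => q Hq Hpq /=; apply/esym/(same l) => //.
  exact/component_center.
exists m, lab, es; split=> // [l Hl|l a l' b].
- split=> [C /vertex_component[p Hp ->]|C C'|a Ha].
  + by rewrite /= labE // range.
  + rewrite !inE => /vertex_component[p Hp ->] /vertex_component[q Hq ->].
    by rewrite !labE // => /(same l _ _ Hl Hp Hq); apply: component_eq.
  + have [p Hp <-] := onto l a Hl Ha.
    by exists (component l p); [apply: component_vertex|apply: labE].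
- rewrite mem_es; split=> [[Hl Hl' Harrow [p [Hp <- <-]]]|].
    have Hp' := level_image_sub Harrow Hp.
    exists (component l p), (component l' p); rewrite !labE //; split=> //.
    split=> //; try by split=> //; apply: component_vertex.
    exact: component_sub.
  case=> C [C' [[[Hl HC] [Hl' HC'] Harrow Hsub] <- <-]].
  rewrite /= in HC HC' Hsub; have [p Hp EC] := vertex_component HC.
  have [q Hq EC'] := vertex_component HC'.
  have Hp' := level_image_sub Harrow Hp.
  have Epq : component l' q = component l' p.
    apply: component_eq => //; apply/component_center => //.
    by rewrite -EC'; apply: Hsub; rewrite EC; apply: component_self.
  by split=> //; exists p; rewrite EC EC' Epq !labE.
Qed.

End Components.

Theorem mainTheorem3 :
  exists (P : ram_program) (c : nat),
  forall (n w h : nat), (0 < n)%N -> (0 < w)%N -> (0 < h)%N ->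
  forall V : video n w h,
  exists (t : nat) (out : seq nat),
    [/\ computes_in P (encode_video V) t out,
        (t <= c * (n * w * h))%N
      & forall R : realType, outputs_merge_graph R V out].
Proof.
exists (compile merge_graph_program 0 0), (130 * 100)%N => n w h n_gt0 w_gt0 h_gt0 V.
have [t [out [Hc le_t Hg]]] := program_correct V n_gt0 w_gt0 h_gt0.
by exists t, out; split=> // R; apply: pixel_merge_graph_outputs.
Qed.
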